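(* Suppose that $z \in \rho(A)$ and \begin{itemize} \item $z \notin \mathcal{S}$; \item the characteristic polynomial $\mathcal{P}$ (with $\lambda$ replaced by $z$) has $2N$ distinct roots, denoted $\pm\rho_i(z)$, $i=1,\ldots,N$; \item $k_j(z) \neq \pm \rho_i(z)$ for all $i,j = 1,\ldots,N$; and \item the $2N\times 2N$ matrix $T(z)$ is invertible. \end{itemize} Then the solution $\psi$ of the resolvent equation $(z - A)\psi = \phi$ (for given $\phi \in X$) is given by $\psi_z = \varepsilon_z \otimes q_z + H_z\phi$, where \[ q_z(x) = \frac{h_z(x)}{z+\alpha} + \sum_{i=1}^{N}\bigl[\gamma_{i,z}(x)e^{\rho_i(z)x} + \gamma_{-i,z}(x)e^{-\rho_i(z)x}\bigr] \qquad \forall\, x \in [-1,1], \] with $\Gamma_z = [\gamma_{1,z},\ldots,\gamma_{N,z},\gamma_{-1,z},\ldots,\gamma_{-N,z}]$ given by \[ \Gamma_z(x) = \Gamma_{0,z} + \hat\Gamma_z(x), \qquad \hat\Gamma_z(x) = \int_{x_0}^{x} \frac{h_z(r)}{z+\alpha}\begin{bmatrix} P^-_z(r) & 0 \\ 0 & P^+_z(r)\end{bmatrix} T(z)^{-1}\begin{bmatrix} -\mathbf{1} \\ \mathbf{1}\end{bmatrix} dr, \] for a reference point $x_0 \in [-1,1]$, and \[ \Gamma_{0,z} = -S(z)^{-1}\begin{bmatrix} S^-_z & S^+_z & 0 & 0\\ 0 & 0 & S^+_z & S^-_z\end{bmatrix}\begin{bmatrix}\hat\Gamma_z(1)\\ \hat\Gamma_z(-1)\end{bmatrix},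 \] and where \[ h_z(x) = \phi(0,x) + \int_{-1}^{1}\int_{-\tau_0-|x-r|}^{0} J(x,r)\,e^{-z(\tau_0+s)-z|x-r|}\,\phi(s,r)\,ds\,dr \qquad \forall\,x\in[-1,1]. \]
   Context: Setting: $Y = C([-1,1])$ (complex-valued continuous functions, sup norm), $\tau_0 \ge 0$, $h = \tau_0 + 2$, $X = C([-h,0];Y)$, $\alpha > 0$. Delay $\tau(x,r) = \tau_0 + |x-r|$ and connectivity $J(x,r) = \sum_{i=1}^N c_i e^{-\mu_i|x-r|}$ with $c_i \in \mathbb{C}\setminus\{0\}$ and pairwise distinct $\mu_i \in \mathbb{C}$. Let $L \in \mathcal{L}(X,Y)$, $(L\phi)(x) = \int_{-1}^1 J(x,r)\phi(-\tau_0-|x-r|,r)\,dr$, and let $A$ be the generator of the solution semigroup of $\dot V(t) = -\alpha V(t) + L V_t$: $D(A) = \{\phi \in X : \phi' \in X,\ \phi'(0) = -\alpha\phi(0) + L\phi\}$, $A\phi = \phi'$; $\rho(A)$ is its resolvent set. For $z\in\mathbb{C}$: $\varepsilon_z(\theta) = e^{z\theta}$, $(\varepsilon_z\otimes q)(\theta) = e^{z\theta}q$ for $q\in Y$, and $(H_z\phi)(\theta) = \int_\theta^0 e^{z(\theta-s)}\phi(s)\,ds$, $\theta\in[-h,0]$. Let $k_i(z) = z + \mu_i$ and $\mathcal{S} = \{z \in \mathbb{C} : k_i(z)^2 = k_j(z)^2 \text{ for some } i \neq j\}$. The characteristic polynomial is $\mathcal{P}(\rho) = \tfrac{1}{2}e^{z\tau_0}(z+\alpha)\prod_{j=1}^N(\rho^2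 - k_j(z)^2) + \sum_{i=1}^N c_i k_i(z)\prod_{j\ne i}(\rho^2 - k_j(z)^2)$. With roots $\pm\rho_i(z)$: $T(z) = \begin{bmatrix} T^-_z & T^+_z\\ T^+_z & T^-_z\end{bmatrix}$, $[T^\pm_z]_{j,i} = 1/(k_j(z) \pm \rho_i(z))$; $P^\pm_z(x) = \mathrm{diag}(e^{\pm\rho_1(z)x},\ldots,e^{\pm\rho_N(z)x})$; $\mathbf{1}\in\mathbb{R}^N$ is the all-ones vector; $S(z) = \begin{bmatrix} S^-_z & S^+_z\\ S^+_z & S^-_z\end{bmatrix}$ with $[S^-_z]_{j,i} = e^{\rho_i(z)}/(z+\mu_j-\rho_i(z))$, $[S^+_z]_{j,i} = e^{-\rho_i(z)}/(z+\mu_j+\rho_i(z))$. *)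

(* Defs.v *)
From Stdlib Require Import Reals Lra.
From Coquelicot Require Import Coquelicot.
Open Scope R_scope.

Definition cexp (w : C) : C := (exp (fst w) * cos (snd w), exp (fst w) * sin (snd w)).

Definition CInt (f : R -> C) (a b : R) : C := @RInt C_R_CompleteNormedModule f a b.

Fixpoint csum (n : nat) (f : nat -> C) : C :=
  match n with O => RtoC 0 | S m => Cplus (csum m f) (f m) end.
Fixpoint cprod (n : nat) (f : nat -> C) : C :=
  match n with O => RtoC 1 | S m => Cmult (cprod m f) (f m) end.

Open Scope C_scope.

Definition mmul (n : nat) (A B : nat -> nat -> C) : nat -> nat -> C :=
  fun i j => csum n (fun k => A i k * B k j).
Definition mvec (n : nat) (A : nat -> nat -> C) (v : nat -> C) : nat -> C :=
  fun i => csum n (fun k => A i k * v k).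
Definition kron (i j : nat) : C := if Nat.eqb i j then RtoC 1 else RtoC 0.
Definition is_inverse (n : nat) (A B : nat -> nat -> C) : Prop :=
  forall i j, (i < n)%nat -> (j < n)%nat ->
    mmul n A B i j = kron i j /\ mmul n B A i j = kron i j.

Definition blk2 (N : nat) (A B : nat -> nat -> C) : nat -> nat -> C :=
  fun r c =>
    if Nat.ltb r N then (if Nat.ltb c N then A r c else B r (c - N)%nat)
    else (if Nat.ltb c N then B (r - N)%nat c else A (r - N)%nat (c - N)%nat).

Definition hh (tau0 : R) : R := tau0 + 2.

Definition Jc (N : nat) (c mu : nat -> C) (x r : R) : C :=
  csum N (fun i => c i * cexp (- mu i * RtoC (Rabs (x - r)%R))).

Definition inY (f : R -> C) : Prop :=
  forall x, -1 <= x <= 1 -> forall eps, 0 < eps -> exists delta, 0 < delta /\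
    forall y, -1 <= y <= 1 -> Rabs (y - x) < delta -> Cmod (f y - f x) < eps.

(** X = C([-h,0]; Y) with the sup norm on Y; phi θ x stands for phi(θ)(x). *)
Definition inX (h : R) (phi : R -> R -> C) : Prop :=
  (forall th, -h <= th <= 0 -> inY (phi th)) /\
  (forall th, -h <= th <= 0 -> forall eps, 0 < eps -> exists delta, 0 < delta /\
     forall th', -h <= th' <= 0 -> Rabs (th' - th) < delta ->
       forall x, -1 <= x <= 1 -> Cmod (phi th' x - phi th x) < eps).

(** dphi is the derivative of θ ↦ phi(θ) ∈ Y (sup norm), one-sided at the endpoints. *)
Definition derivX (h : R) (phi dphi : R -> R -> C) : Prop :=
  forall th, -h <= th <= 0 -> forall eps, 0 < eps -> exists delta, 0 < delta /\
    forall t, t <> 0 -> Rabs t < delta -> -h <= (th + t)%R <= 0 ->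
      forall x, -1 <= x <= 1 ->
        Cmod ((phi (th + t)%R x - phi th x) / RtoC t - dphi th x) < eps.

Definition Lop (N : nat) (c mu : nat -> C) (tau0 : R) (phi : R -> R -> C) (x : R) : C :=
  CInt (fun r => Jc N c mu x r * phi (- tau0 - Rabs (x - r))%R r) (-1) 1.

(** psi ∈ D(A) with A psi = dpsi. *)
Definition in_DA (N : nat) (c mu : nat -> C) (tau0 alpha : R)
    (psi dpsi : R -> R -> C) : Prop :=
  inX (hh tau0) psi /\ derivX (hh tau0) psi dpsi /\ inX (hh tau0) dpsi /\
  (forall x, -1 <= x <= 1 ->
     dpsi 0 x = - RtoC alpha * psi 0 x + Lop N c mu tau0 psi x).

Definition solves_resolvent (N : nat) (c mu : nat -> C) (tau0 alpha : R) (z : C)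
    (phi psi : R -> R -> C) : Prop :=
  exists dpsi, in_DA N c mu tau0 alpha psi dpsi /\
    forall th x, - hh tau0 <= th <= 0 -> -1 <= x <= 1 ->
      z * psi th x - dpsi th x = phi th x.

Definition in_resolvent_set (N : nat) (c mu : nat -> C) (tau0 alpha : R) (z : C) : Prop :=
  (forall phi, inX (hh tau0) phi -> exists psi, solves_resolvent N c mu tau0 alpha z phi psi) /\
  (forall phi psi1 psi2,
     solves_resolvent N c mu tau0 alpha z phi psi1 ->
     solves_resolvent N c mu tau0 alpha z phi psi2 ->
     forall th x, - hh tau0 <= th <= 0 -> -1 <= x <= 1 -> psi1 th x = psi2 th x) /\
  (exists K, 0 <= K /\ forall phi psi, inX (hh tau0) phi ->
     solves_resolvent N c mu tau0 alpha z phi psi ->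
     forall M, (forall th x, - hh tau0 <= th <= 0 -> -1 <= x <= 1 -> Cmod (phi th x) <= M) ->
     forall th x, - hh tau0 <= th <= 0 -> -1 <= x <= 1 -> Cmod (psi th x) <= K * M).

Definition kk (mu : nat -> C) (z : C) (i : nat) : C := z + mu i.

Definition charP (N : nat) (c mu : nat -> C) (tau0 alpha : R) (z w : C) : C :=
  RtoC (1/2) * cexp (z * RtoC tau0) * (z + RtoC alpha) *
    cprod N (fun j => w * w - kk mu z j * kk mu z j)
  + csum N (fun i => c i * kk mu z i *
      cprod N (fun j => if Nat.eqb j i then RtoC 1 else w * w - kk mu z j * kk mu z j)).

(** the list of the 2N roots: index a < N is ρ_{a+1}, index N + i is -ρ_{i+1} *)
Definition signed_root (N : nat) (rho : nat -> C) (a : nat) : C :=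
  if Nat.ltb a N then rho a else - rho (a - N)%nat.

Definition Tm (N : nat) (mu : nat -> C) (z : C) (rho : nat -> C) : nat -> nat -> C :=
  blk2 N (fun j i => / (kk mu z j - rho i)) (fun j i => / (kk mu z j + rho i)).
Definition Sminus (mu : nat -> C) (z : C) (rho : nat -> C) : nat -> nat -> C :=
  fun j i => cexp (rho i) / (z + mu j - rho i).
Definition Splus (mu : nat -> C) (z : C) (rho : nat -> C) : nat -> nat -> C :=
  fun j i => cexp (- rho i) / (z + mu j + rho i).
Definition Sm (N : nat) (mu : nat -> C) (z : C) (rho : nat -> C) : nat -> nat -> C :=
  blk2 N (Sminus mu z rho) (Splus mu z rho).

Definition hz (N : nat) (c mu : nat -> C) (tau0 : R) (z : C) (phi : R -> R -> C) (x : R) : C :=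
  phi 0 x + CInt (fun r => CInt (fun s =>
      Jc N c mu x r * cexp (- z * RtoC (tau0 + s)%R - z * RtoC (Rabs (x - r)%R)) * phi s r)
      (- tau0 - Rabs (x - r))%R 0) (-1)%R 1.

Definition Pdiag (N : nat) (rho : nat -> C) (r : R) (a : nat) : C :=
  if Nat.ltb a N then cexp (- rho a * RtoC r) else cexp (rho (a - N)%nat * RtoC r).

Definition pm_ones (N : nat) (a : nat) : C := if Nat.ltb a N then RtoC (-1) else RtoC 1.

Definition Gammahat (N : nat) (c mu : nat -> C) (tau0 alpha : R) (z : C)
    (rho : nat -> C) (Tinv : nat -> nat -> C) (phi : R -> R -> C) (x0 x : R) (a : nat) : C :=
  CInt (fun r => hz N c mu tau0 z phi r / (z + RtoC alpha) *
                 (Pdiag N rho r a * mvec (2 * N) Tinv (pm_ones N) a)) x0 x.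

Definition Sbig (N : nat) (mu : nat -> C) (z : C) (rho : nat -> C) : nat -> nat -> C :=
  fun r col =>
    if Nat.ltb r N then
      (if Nat.ltb col N then Sminus mu z rho r col
       else if Nat.ltb col (2 * N) then Splus mu z rho r (col - N)%nat
       else RtoC 0)
    else
      (if Nat.ltb col (2 * N) then RtoC 0
       else if Nat.ltb col (3 * N) then Splus mu z rho (r - N)%nat (col - 2 * N)%nat
       else Sminus mu z rho (r - N)%nat (col - 3 * N)%nat).

Definition Gamma0 (N : nat) (c mu : nat -> C) (tau0 alpha : R) (z : C)
    (rho : nat -> C) (Tinv Sinv : nat -> nat -> C) (phi : R -> R -> C) (x0 : R) (a : nat) : C :=
  let G := Gammahat N c mu tau0 alpha z rho Tinv phi x0 in
  let stacked := fun b => if Nat.ltb b (2 * N) then G 1 b else G (-1) (b - 2 * N)%nat in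
  - mvec (2 * N) Sinv (mvec (4 * N) (Sbig N mu z rho) stacked) a.

Definition Gammaz (N : nat) (c mu : nat -> C) (tau0 alpha : R) (z : C)
    (rho : nat -> C) (Tinv Sinv : nat -> nat -> C) (phi : R -> R -> C) (x0 x : R) (a : nat) : C :=
  Gamma0 N c mu tau0 alpha z rho Tinv Sinv phi x0 a
  + Gammahat N c mu tau0 alpha z rho Tinv phi x0 x a.

(** q_z(x): γ_{i+1} is component i, γ_{-(i+1)} is component N + i *)
Definition qz (N : nat) (c mu : nat -> C) (tau0 alpha : R) (z : C)
    (rho : nat -> C) (Tinv Sinv : nat -> nat -> C) (phi : R -> R -> C) (x0 x : R) : C :=
  let G := Gammaz N c mu tau0 alpha z rho Tinv Sinv phi x0 x in
  hz N c mu tau0 z phi x / (z + RtoC alpha)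
  + csum N (fun i => G i * cexp (rho i * RtoC x) + G (N + i)%nat * cexp (- rho i * RtoC x)).

(** (ε_z ⊗ q)(θ) + (H_z phi)(θ), evaluated at x *)
Definition resolvent_formula (z : C) (q : R -> C) (phi : R -> R -> C) (th x : R) : C :=
  cexp (z * RtoC th) * q x + CInt (fun s => cexp (z * RtoC (th - s)%R) * phi s x) th 0.

(* Main.v *)
(* With [q = psi(0)], variation of constants in theta turns the resolvent equation into the integral
   equation (z + alpha) q - K q = h_z on [-1,1], where K has the kernel
   e^{-z tau0} sum_j c_j e^{-k_j |x - r|}. Write s_a for the 2N roots +-rho_i and look for
   q = h_z / (z + alpha) + sum_a gamma_a e^{s_a x}. Taking gamma_a' = (h_z / (z + alpha)) w_a e^{-s_a x}
   with T w = (-1, 1) makes e^{+-k_j r} q(r) the derivative of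
   sum_a gamma_a e^{(+-k_j + s_a) r} / (+-k_j + s_a). Hence K q is explicit: its interior part is
   (z + alpha) sum_a gamma_a e^{s_a x} because P(s_a) = 0, and its boundary part vanishes exactly when
   the rows of S annihilate gamma(1) and gamma(-1), which is how Gamma_0 is chosen.
   Since z is in the resolvent set the homogeneous integral equation has only the zero solution. This
   identifies q with the ansatz and, applied with constant gamma in ker S and h_z = 0 together with the
   independence of the exponentials, shows that S is injective. *)

Require Import Defs.
From Stdlib Require Import Reals Lra Lia.
From Coquelicot Require Import Coquelicot.
Open Scope C_scope.

(** * Finite sums and square linear systems over the complex numbers *)

Lemma csum_ext (n : nat) (f g : nat -> C) :
  (forall i, (i < n)%nat -> f i = g i) -> csum n f = csum n g.
Proof.
induction n as [|n IH]; simpl; intros Hfg; [reflexivity|].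
rewrite IH by (intros; apply Hfg; lia). now rewrite Hfg by lia.
Qed.

Lemma csum_plus (n : nat) (f g : nat -> C) :
  csum n (fun i => f i + g i) = csum n f + csum n g.
Proof. induction n as [|n IH]; simpl; [ring|]. rewrite IH. ring. Qed.

Lemma csum_scal (n : nat) (a : C) (f : nat -> C) :
  csum n (fun i => a * f i) = a * csum n f.
Proof. induction n as [|n IH]; simpl; [ring|]. rewrite IH. ring. Qed.

Lemma csum_zero (n : nat) (f : nat -> C) :
  (forall i, (i < n)%nat -> f i = 0) -> csum n f = 0.
Proof.
induction n as [|n IH]; simpl; intros Hf; [reflexivity|].
rewrite IH by (intros; apply Hf; lia). rewrite Hf by lia. ring.
Qed.

Lemma csum_exchange (m n : nat) (f : nat -> nat -> C) :
  csum m (fun i => csum n (f i)) = csum n (fun j => csum m (fun i => f i j)).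
Proof.
induction m as [|m IH]; simpl; [symmetry; now apply csum_zero|].
now rewrite IH, csum_plus.
Qed.

Lemma csum_split (m n : nat) (f : nat -> C) :
  csum (m + n) f = csum m f + csum n (fun i => f (m + i)%nat).
Proof.
induction n as [|n IH]; simpl.
- rewrite Nat.add_0_r. ring.
- rewrite Nat.add_succ_r. simpl. rewrite IH. ring.
Qed.

Lemma csum_double (n : nat) (f : nat -> C) :
  csum (2 * n) f = csum n (fun i => f i + f (n + i)%nat).
Proof. simpl. now rewrite Nat.add_0_r, csum_split, csum_plus. Qed.

Lemma kron_diag (i : nat) : kron i i = 1.
Proof. unfold kron. now rewrite Nat.eqb_refl. Qed.

Lemma kron_neq (i j : nat) : i <> j -> kron i j = 0.
Proof. intros H. unfold kron. now apply Nat.eqb_neq in H as ->. Qed.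

Lemma csum_kron (n i : nat) (v : nat -> C) :
  (i < n)%nat -> csum n (fun k => kron i k * v k) = v i.
Proof.
induction n as [|n IH]; intros Hi; [lia|]. simpl.
destruct (Nat.eq_dec i n) as [->|Hin].
- rewrite csum_zero, kron_diag; [ring|].
  intros k Hk. rewrite kron_neq by lia. ring.
- rewrite IH, (kron_neq i n Hin) by lia. ring.
Qed.

Lemma mvec_mvec (n : nat) (A B : nat -> nat -> C) (v : nat -> C) (i : nat) :
  mvec n A (mvec n B v) i = mvec n (mmul n A B) v i.
Proof.
unfold mvec, mmul.
rewrite (csum_ext n _ (fun k => csum n (fun j => A i k * (B k j * v j))))
  by (intros; symmetry; apply csum_scal).
rewrite csum_exchange. apply csum_ext. intros j _.
rewrite Cmult_comm, <- csum_scal. apply csum_ext. intros; ring.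
Qed.

Lemma mvec_inverse (n : nat) (A B : nat -> nat -> C) (v : nat -> C) (i : nat) :
  is_inverse n A B -> (i < n)%nat -> mvec n A (mvec n B v) i = v i.
Proof.
intros HAB Hi. rewrite mvec_mvec, <- (csum_kron n i v Hi).
apply csum_ext. intros j Hj. now rewrite (proj1 (HAB i j Hi Hj)).
Qed.

(** With one unknown more than equations, eliminating the last unknown leaves a system of the same
    shape, so induction on [n] applies. All matrix facts below rest on this instead of
    determinants. *)
Lemma underdetermined_kernel (n : nat) :
  forall A : nat -> nat -> C, exists v : nat -> C,
    (exists i, (i <= n)%nat /\ v i <> 0) /\
    forall i, (i < n)%nat -> csum (S n) (fun j => A i j * v j) = 0.
Proof.
induction n as [|n IH]; intros A.
- exists (fun _ => 1). split; [|intros; lia].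
  exists 0%nat. split; [lia|]. apply C1_nz.
- assert (Hpiv : (forall p, (p < S n)%nat -> A p (S n) = 0) \/
                 exists p, (p < S n)%nat /\ A p (S n) <> 0).
  (* Only the two bounds on the row index are generalized; the column stays [S n]. The induction
     then searches that column for a pivot. *)
  { generalize (S n) at 1 3. intros m. induction m as [|m IHm].
    - left. intros; lia.
    - destruct IHm as [H0|[p [Hp Hn]]]; [|right; exists p; split; [lia|easy]].
      destruct (Ceq_dec (A m (S n)) 0) as [Hz|Hz]; [|right; exists m; split; [lia|easy]].
      left. intros p Hp. destruct (Nat.eq_dec p m) as [->|]; [easy|]. apply H0. lia. }
  destruct Hpiv as [H0|[p [Hp Hnz]]].
  + exists (kron (S n)). split.
    * exists (S n). split; [lia|]. rewrite kron_diag. apply C1_nz.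
    * intros i Hi.
      rewrite (csum_ext _ _ (fun j => kron (S n) j * A i j)) by (intros; ring).
      rewrite csum_kron by lia. now apply H0.
  + (* gaussian elimination of the last unknown with pivot row [p] *)
    (* [sw] enumerates the rows other than [p]: row [n] takes the slot that [p] leaves free. *)
    set (sw := fun i => if Nat.eqb i p then n else i).
    destruct (IH (fun i j => A (sw i) j - A (sw i) (S n) / A p (S n) * A p j))
      as [v [[i0 [Hi0 Hv0]] Hv]].
    (* The value of the last unknown that makes the pivot row vanish. *)
    set (last := - csum (S n) (fun j => A p j * v j) / A p (S n)).
    exists (fun j => if Nat.eqb j (S n) then last else v j).
    assert (Hsum : forall i,
      csum (S (S n)) (fun j => A i j * (if Nat.eqb j (S n) then last else v j)) =
      csum (S n) (fun j => A i j * v j) + A i (S n) * last).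
    { intros i. change (csum (S (S n)) ?f) with (csum (S n) f + f (S n)).
      cbv beta. rewrite Nat.eqb_refl. f_equal. apply csum_ext. intros j Hj.
      now replace (Nat.eqb j (S n)) with false by (symmetry; apply Nat.eqb_neq; lia). }
    split.
    * exists i0. split; [lia|].
      now replace (Nat.eqb i0 (S n)) with false by (symmetry; apply Nat.eqb_neq; lia).
    * intros i Hi. rewrite Hsum.
      destruct (Nat.eq_dec i p) as [->|Hip]; [unfold last; field; exact Hnz|].
      assert (Hrow : exists i', (i' < n)%nat /\ sw i' = i).
      { destruct (Nat.eq_dec i n) as [->|Hin].
        - exists p. split; [lia|]. unfold sw. now rewrite Nat.eqb_refl.
        - exists i. split; [lia|]. unfold sw. now apply Nat.eqb_neq in Hip as ->. }
      destruct Hrow as [i' [Hi' Hsw]]. specialize (Hv i' Hi'). cbv beta in Hv.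
      rewrite Hsw in Hv.
      rewrite (csum_ext _ _ (fun j => A i j * v j +
        (- (A i (S n) / A p (S n))) * (A p j * v j))) in Hv by (intros; ring).
      rewrite csum_plus, csum_scal in Hv.
      rewrite <- Hv. unfold last. field. exact Hnz.
Qed.

(** The augmented matrix [[A | b]] has a nonzero kernel vector. Injectivity of [A] forces its last
    entry to be nonzero, and dividing the others by minus that entry solves the system. *)
Lemma injective_solvable (n : nat) (A : nat -> nat -> C) (b : nat -> C) :
  (forall v, (forall i, (i < n)%nat -> mvec n A v i = 0) ->
     forall i, (i < n)%nat -> v i = 0) ->
  exists v, forall i, (i < n)%nat -> mvec n A v i = b i.
Proof.
intros Hinj.
destruct (underdetermined_kernel n (fun i j => if Nat.eqb j n then b i else A i j))
  as [v [[i0 [Hi0 Hv0]] Hv]].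
assert (Hv' : forall i, (i < n)%nat -> mvec n A v i + b i * v n = 0).
{ intros i Hi. rewrite <- (Hv i Hi). simpl. rewrite Nat.eqb_refl. f_equal.
  apply csum_ext. intros j Hj.
  now replace (Nat.eqb j n) with false by (symmetry; apply Nat.eqb_neq; lia). }
assert (Hvn : v n <> 0).
{ intros Hvn. apply Hv0. destruct (Nat.eq_dec i0 n) as [->|]; [easy|].
  apply Hinj; [|lia]. intros i Hi. rewrite <- (Hv' i Hi), Hvn. ring. }
exists (fun j => (- / v n) * v j). intros i Hi.
transitivity ((- / v n) * mvec n A v i).
- unfold mvec. rewrite <- csum_scal. apply csum_ext. intros; ring.
- replace (mvec n A v i) with (mvec n A v i + b i * v n - b i * v n) by ring.
  rewrite (Hv' i Hi). field. exact Hvn.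
Qed.

(** Induction on [n] makes the finitely many choices, so no choice axiom enters; [t0] is the value
    at indices outside the range. *)
Lemma finite_choice {T : Type} (t0 : T) (n : nat) (P : nat -> T -> Prop) :
  (forall i, (i < n)%nat -> exists t, P i t) ->
  exists f, forall i, (i < n)%nat -> P i (f i).
Proof.
induction n as [|n IH]; intros H.
- exists (fun _ => t0). intros; lia.
- destruct IH as [f Hf]; [intros; apply H; lia|].
  destruct (H n (Nat.lt_succ_diag_r n)) as [t Ht].
  exists (fun i => if Nat.eqb i n then t else f i). intros i Hi.
  destruct (Nat.eqb_spec i n) as [->|]; [easy|]. apply Hf. lia.
Qed.

Lemma injective_right_inverse (n : nat) (A : nat -> nat -> C) :
  (forall v, (forall i, (i < n)%nat -> mvec n A v i = 0) ->
     forall i, (i < n)%nat -> v i = 0) ->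
  exists B, forall i j, (i < n)%nat -> (j < n)%nat -> mmul n A B i j = kron i j.
Proof.
intros Hinj.
destruct (finite_choice (fun _ : nat => RtoC 0) n
  (fun j v => forall i, (i < n)%nat -> mvec n A v i = kron i j)) as [B HB].
- intros j _. now apply injective_solvable.
- exists (fun i j => B j i). intros i j Hi Hj. now apply HB.
Qed.

Lemma mvec_ext (n : nat) (A : nat -> nat -> C) (v w : nat -> C) (i : nat) :
  (forall j, (j < n)%nat -> v j = w j) -> mvec n A v i = mvec n A w i.
Proof. intros H. apply csum_ext. intros j Hj. now rewrite H. Qed.

Lemma mvec_minus (n : nat) (A : nat -> nat -> C) (v w : nat -> C) (i : nat) :
  mvec n A (fun k => v k - w k) i = mvec n A v i - mvec n A w i.
Proof.
unfold mvec. rewrite (csum_ext n _ (fun k => A i k * v k + (-(1)) * (A i k * w k)))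
  by (intros; ring).
rewrite csum_plus, csum_scal. ring.
Qed.

(** The form in which invertibility of [Sm] is obtained: its kernel is accessible through uniqueness
    for the resolvent equation. *)
Lemma injective_invertible (n : nat) (A : nat -> nat -> C) :
  (forall v, (forall i, (i < n)%nat -> mvec n A v i = 0) ->
     forall i, (i < n)%nat -> v i = 0) ->
  exists B, is_inverse n A B.
Proof.
intros Hinj.
destruct (injective_right_inverse n A Hinj) as [B HAB]. exists B.
assert (HAB' : forall v i, (i < n)%nat -> mvec n A (mvec n B v) i = v i).
{ intros v i Hi. rewrite mvec_mvec, <- (csum_kron n i v Hi).
  apply csum_ext. intros j Hj. now rewrite HAB. }
intros i j Hi Hj. split; [now apply HAB|].
(* [A (B A e_j - e_j) = 0] *)
assert (H0 : mvec n B (mvec n A (fun k => kron k j)) i - kron i j = 0).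
{ apply (Hinj (fun i => mvec n B (mvec n A (fun k => kron k j)) i - kron i j)); [|easy].
  intros k Hk.
  rewrite (mvec_minus n A (mvec n B (mvec n A (fun k => kron k j))) (fun k => kron k j)).
  rewrite HAB' by easy. ring. }
rewrite mvec_mvec in H0.
transitivity (mvec n (mmul n B A) (fun k => kron k j) i).
- rewrite <- (csum_kron n j (mmul n B A i) Hj). apply csum_ext. intros k _.
  unfold kron. rewrite Nat.eqb_sym. ring.
- replace (kron i j) with (0 + kron i j) by ring. rewrite <- H0. ring.
Qed.

(** * Continuity and differentiation of complex functions of a real variable *)

(** Continuity and derivatives are taken componentwise so that the real-variable calculus applies
    directly; [Ccont_eps] and [Cderiv_quotient] translate to the modulus. *)
Definition Ccont (f : R -> C) (x : R) : Prop :=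
  continuity_pt (fun t => fst (f t)) x /\ continuity_pt (fun t => snd (f t)) x.

Definition Cderiv (f : R -> C) (x : R) (l : C) : Prop :=
  derivable_pt_lim (fun t => fst (f t)) x (fst l) /\
  derivable_pt_lim (fun t => snd (f t)) x (snd l).

Lemma Ccont_const (a : C) (x : R) : Ccont (fun _ => a) x.
Proof. split; now apply continuity_pt_const; intros ? ?. Qed.

Lemma Ccont_RtoC (f : R -> R) (x : R) :
  continuity_pt f x -> Ccont (fun t => RtoC (f t)) x.
Proof. intros H. split; [exact H|]. now apply continuity_pt_const; intros ? ?. Qed.

Lemma Ccont_plus (f g : R -> C) (x : R) :
  Ccont f x -> Ccont g x -> Ccont (fun t => f t + g t) x.
Proof.
intros [F1 F2] [G1 G2].
split; [exact (continuity_pt_plus _ _ _ F1 G1)|exact (continuity_pt_plus _ _ _ F2 G2)].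
Qed.

Lemma Ccont_mult (f g : R -> C) (x : R) :
  Ccont f x -> Ccont g x -> Ccont (fun t => f t * g t) x.
Proof.
intros [F1 F2] [G1 G2]. split.
- exact (continuity_pt_minus _ _ _ (continuity_pt_mult _ _ _ F1 G1)
           (continuity_pt_mult _ _ _ F2 G2)).
- exact (continuity_pt_plus _ _ _ (continuity_pt_mult _ _ _ F1 G2)
           (continuity_pt_mult _ _ _ F2 G1)).
Qed.

Lemma Ccont_ext (f g : R -> C) (x : R) :
  (forall t, f t = g t) -> Ccont f x -> Ccont g x.
Proof.
intros H [F1 F2]. split.
- apply (continuity_pt_ext (fun t => fst (f t))); [intros t; now rewrite H|exact F1].
- apply (continuity_pt_ext (fun t => snd (f t))); [intros t; now rewrite H|exact F2].
Qed.

Lemma Ccont_csum (n : nat) (f : nat -> R -> C) (x : R) :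
  (forall i, (i < n)%nat -> Ccont (f i) x) -> Ccont (fun t => csum n (fun i => f i t)) x.
Proof.
induction n as [|n IH]; intros H; simpl; [apply Ccont_const|].
apply Ccont_plus; [apply IH; intros; apply H; lia|apply H; lia].
Qed.

Lemma Ccont_comp (g : R -> R) (f : R -> C) (x : R) :
  continuity_pt g x -> Ccont f (g x) -> Ccont (fun t => f (g t)) x.
Proof.
intros G [F1 F2]. split.
- exact (continuity_pt_comp g (fun t => fst (f t)) x G F1).
- exact (continuity_pt_comp g (fun t => snd (f t)) x G F2).
Qed.

Lemma Ccont_eps (f : R -> C) (x : R) :
  Ccont f x <-> forall eps, (0 < eps)%R -> exists delta, (0 < delta)%R /\
    forall y, (Rabs (y - x) < delta)%R -> (Cmod (f y - f x) < eps)%R.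
Proof.
assert (Hpt : forall g : R -> R, continuity_pt g x <->
  forall eps, (0 < eps)%R -> exists delta, (0 < delta)%R /\
    forall y, (Rabs (y - x) < delta)%R -> (Rabs (g y - g x) < eps)%R).
{ intros g. split; intros Hg eps Heps; destruct (Hg eps Heps) as [d [Hd Hg']];
    exists d; (split; [exact Hd|]).
  - intros y Hy. destruct (Req_dec x y) as [<-|Hxy].
    (* [continuity_pt] only speaks of points different from [x], so [y = x] is treated apart. *)
    + now rewrite Rminus_diag, Rabs_R0.
    + apply Hg'. split; [now split|exact Hy].
  - intros y [_ Hy]. now apply Hg'. }
unfold Ccont. rewrite !Hpt. split.
- intros [F1 F2] eps Heps.
  destruct (F1 (eps / 2)%R) as [d1 [Hd1 G1]]; [lra|].
  destruct (F2 (eps / 2)%R) as [d2 [Hd2 G2]]; [lra|].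
  exists (Rmin d1 d2). split; [now apply Rmin_glb_lt|]. intros y Hy.
  pose proof (Rmin_l d1 d2). pose proof (Rmin_r d1 d2).
  specialize (G1 y ltac:(lra)). specialize (G2 y ltac:(lra)).
  replace (f y - f x) with (RtoC (fst (f y) - fst (f x)) + Ci * RtoC (snd (f y) - snd (f x))).
  + eapply Rle_lt_trans; [apply Cmod_triangle|].
    rewrite Cmod_mult, !Cmod_R, Cmod_Ci. lra.
  + apply injective_projections; simpl; ring.
- intros H. split; intros eps Heps; destruct (H eps Heps) as [d [Hd G]];
    exists d; (split; [exact Hd|]); intros y Hy; specialize (G y Hy);
    eapply Rle_lt_trans; try exact G;
    (eapply Rle_trans; [|apply (Rmax_Cmod (f y - f x))]);
    [eapply Rle_trans; [|apply Rmax_l]|eapply Rle_trans; [|apply Rmax_r]];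
    apply Req_le; reflexivity.
Qed.

Lemma Cderiv_cont (f : R -> C) (x : R) (l : C) : Cderiv f x l -> Ccont f x.
Proof.
intros [F1 F2].
split; apply derivable_continuous_pt; eexists; eassumption.
Qed.

Lemma Cderiv_const (a : C) (x : R) : Cderiv (fun _ => a) x 0.
Proof. split; apply derivable_pt_lim_const. Qed.

Lemma Cderiv_plus (f g : R -> C) (x : R) (l m : C) :
  Cderiv f x l -> Cderiv g x m -> Cderiv (fun t => f t + g t) x (l + m).
Proof.
intros [F1 F2] [G1 G2].
split; [exact (derivable_pt_lim_plus _ _ _ _ _ F1 G1)|
        exact (derivable_pt_lim_plus _ _ _ _ _ F2 G2)].
Qed.

Lemma Cderiv_eq (f : R -> C) (x : R) (l m : C) : l = m -> Cderiv f x l -> Cderiv f x m.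
Proof. now intros ->. Qed.

Lemma Cderiv_mult (f g : R -> C) (x : R) (l m : C) :
  Cderiv f x l -> Cderiv g x m -> Cderiv (fun t => f t * g t) x (l * g x + f x * m).
Proof.
intros [F1 F2] [G1 G2].
apply (Cderiv_eq _ _
  ((fst l * fst (g x) + fst (f x) * fst m - (snd l * snd (g x) + snd (f x) * snd m))%R,
   (fst l * snd (g x) + fst (f x) * snd m + (snd l * fst (g x) + snd (f x) * fst m))%R)).
- apply injective_projections; simpl; ring.
- split.
  + exact (derivable_pt_lim_minus _ _ _ _ _ (derivable_pt_lim_mult _ _ _ _ _ F1 G1)
             (derivable_pt_lim_mult _ _ _ _ _ F2 G2)).
  + exact (derivable_pt_lim_plus _ _ _ _ _ (derivable_pt_lim_mult _ _ _ _ _ F1 G2)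
             (derivable_pt_lim_mult _ _ _ _ _ F2 G1)).
Qed.

Lemma Cderiv_scal (a : C) (f : R -> C) (x : R) (l : C) :
  Cderiv f x l -> Cderiv (fun t => a * f t) x (a * l).
Proof.
intros H. eapply Cderiv_eq; [|apply (Cderiv_mult _ _ _ _ _ (Cderiv_const a x) H)].
ring.
Qed.

Lemma Cderiv_csum (n : nat) (f : nat -> R -> C) (x : R) (l : nat -> C) :
  (forall i, (i < n)%nat -> Cderiv (f i) x (l i)) ->
  Cderiv (fun t => csum n (fun i => f i t)) x (csum n l).
Proof.
induction n as [|n IH]; intros H; simpl; [apply Cderiv_const|].
apply Cderiv_plus; [apply IH; intros; apply H; lia|apply H; lia].
Qed.

Lemma Cderiv_cexp (w : C) (x : R) :
  Cderiv (fun t => cexp (w * RtoC t)) x (w * cexp (w * RtoC x)).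
Proof.
destruct w as [u v].
assert (Hlin : forall k, derivable_pt_lim (fun t => k * t)%R x k).
{ intros k. pose proof (derivable_pt_lim_scal id k x 1 (derivable_pt_lim_id x)) as H.
  now rewrite Rmult_1_r in H. }
assert (E := derivable_pt_lim_comp _ exp x _ _ (Hlin u) (derivable_pt_lim_exp (u * x)%R)).
assert (Co := derivable_pt_lim_comp _ cos x _ _ (Hlin v) (derivable_pt_lim_cos (v * x)%R)).
assert (Si := derivable_pt_lim_comp _ sin x _ _ (Hlin v) (derivable_pt_lim_sin (v * x)%R)).
assert (H : Cderiv (fun t => (exp (u * t) * cos (v * t), exp (u * t) * sin (v * t))%R) x
  ((u, v) * ((exp (u * x) * cos (v * x), exp (u * x) * sin (v * x))%R))).
{ eapply (Cderiv_eq _ _ (_, _)); [|split; [exact (derivable_pt_lim_mult _ _ _ _ _ E Co)|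
                              exact (derivable_pt_lim_mult _ _ _ _ _ E Si)]].
  apply injective_projections; unfold comp; simpl; ring. }
assert (Heq : forall t, cexp ((u, v) * RtoC t) =
  ((exp (u * t) * cos (v * t), exp (u * t) * sin (v * t))%R)).
{ intros t. unfold cexp. simpl.
  now replace (u * t - v * 0)%R with (u * t)%R by ring;
      replace (u * 0 + v * t)%R with (v * t)%R by ring. }
rewrite Heq. destruct H as [H1 H2].
split; eapply derivable_pt_lim_ext; try eassumption; intros t; cbv beta; now rewrite Heq.
Qed.

(** The mean value theorem fails for complex values, but it can be applied to the real and the
    imaginary part separately. *)
Lemma Cderiv_zero (f : R -> C) (a b : R) :
  (a <= b)%R -> (forall x, (a <= x <= b)%R -> Ccont f x) ->
  (forall x, (a < x < b)%R -> Cderiv f x 0) -> f a = f b.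
Proof.
intros Hab Hc Hd.
assert (Hmvt : forall g : R -> R, (forall x, (a <= x <= b)%R -> continuity_pt g x) ->
  (forall x, (a < x < b)%R -> derivable_pt_lim g x 0) -> g a = g b).
{ intros g Gc Gd. destruct (MVT_gen g a b (fun _ => 0%R)) as [c [_ Hg]].
  - rewrite Rmin_left, Rmax_right by easy. intros x Hx. now apply is_derive_Reals, Gd.
  - rewrite Rmin_left, Rmax_right by easy. exact Gc.
  - lra. }
apply injective_projections.
- apply (Hmvt (fun t => fst (f t))); intros x Hx; [apply (Hc x Hx)|apply (Hd x Hx)].
- apply (Hmvt (fun t => snd (f t))); intros x Hx; [apply (Hc x Hx)|apply (Hd x Hx)].
Qed.

Lemma cexp_0 : cexp 0 = 1.
Proof. unfold cexp. simpl. rewrite exp_0, cos_0, sin_0. apply injective_projections; simpl; ring. Qed.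

Lemma cexp_plus (a b : C) : cexp (a + b) = cexp a * cexp b.
Proof.
unfold cexp. simpl. rewrite exp_plus, cos_plus, sin_plus.
apply injective_projections; simpl; ring.
Qed.

Lemma cexp_opp (a : C) : cexp (- a) * cexp a = 1.
Proof. rewrite <- cexp_plus, <- cexp_0. f_equal. ring. Qed.

Lemma cexp_neq_0 (a : C) : cexp a <> 0.
Proof.
intros H. apply C1_nz. rewrite <- (cexp_opp a), H. ring.
Qed.

(** * Integrals of continuous complex functions *)

(** The order of [a] and [b] is left open because [Gammahat] integrates from [x0] to points on
    either side of it. *)
Lemma CInt_ext_on (l u : R) (f g : R -> C) (a b : R) :
  (l <= a <= u)%R -> (l <= b <= u)%R -> (forall x, (l <= x <= u)%R -> f x = g x) ->
  CInt f a b = CInt g a b.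
Proof.
intros Ha Hb H. apply (RInt_ext (V := C_R_CompleteNormedModule)). intros x Hx. apply H.
revert Hx. unfold Rmin, Rmax. destruct (Rle_dec a b); lra.
Qed.

Lemma CInt_ext (f g : R -> C) (a b : R) :
  (a <= b)%R -> (forall x, (a <= x <= b)%R -> f x = g x) -> CInt f a b = CInt g a b.
Proof. intros Hab H. apply (CInt_ext_on a b); [lra|lra|exact H]. Qed.

Lemma CInt_components (f : R -> C) (a b : R) : (forall x, Ccont f x) ->
  CInt f a b = (RInt (fun t => fst (f t)) a b, RInt (fun t => snd (f t)) a b).
Proof.
intros H. apply (is_RInt_unique (V := C_R_CompleteNormedModule)).
apply (is_RInt_fct_extend_pair (U := R_NormedModule) (V := R_NormedModule) f a b);
  apply (RInt_correct (V := R_CompleteNormedModule)), ex_RInt_continuous;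
  intros x _; apply continuity_pt_filterlim; apply (H x).
Qed.

Lemma CInt_deriv (f : R -> C) (a x : R) : (forall x, Ccont f x) ->
  Cderiv (CInt f a) x (f x).
Proof.
intros H.
assert (Hr : forall g : R -> R, (forall t, continuity_pt g t) ->
  derivable_pt_lim (RInt g a) x (g x)).
{ intros g Hg. apply is_derive_Reals.
  assert (Hg' : forall t, continuous g t)
    by (intros t; now apply continuity_pt_filterlim).
  apply (is_derive_RInt g (RInt g a) a x); [|apply Hg'].
  apply filter_forall. intros y. apply (RInt_correct (V := R_CompleteNormedModule)).
  apply ex_RInt_continuous. intros; apply Hg'. }
split.
- apply (derivable_pt_lim_ext (RInt (fun t => fst (f t)) a));
    [intros y; now rewrite CInt_components|apply (Hr (fun t => fst (f t))), H].
- apply (derivable_pt_lim_ext (RInt (fun t => snd (f t)) a));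
    [intros y; now rewrite CInt_components|apply (Hr (fun t => snd (f t))), H].
Qed.

Lemma CInt_point (f : R -> C) (a : R) : CInt f a a = 0.
Proof. exact (RInt_point (V := C_R_CompleteNormedModule) a f). Qed.

(** [F] minus the indefinite integral of [f] has zero derivative on the interval. Linearity of the
    integral is then obtained by exhibiting primitives. *)
Lemma CInt_FTC (F f : R -> C) (a b : R) : (a <= b)%R -> (forall x, Ccont f x) ->
  (forall x, (a <= x <= b)%R -> Cderiv F x (f x)) -> CInt f a b = F b - F a.
Proof.
intros Hab Hf HF.
assert (E : F a + (-(1)) * CInt f a a = F b + (-(1)) * CInt f a b).
{ assert (D : forall x, (a <= x <= b)%R ->
    Cderiv (fun t => F t + (-(1)) * CInt f a t) x 0).
  { intros x Hx. eapply Cderiv_eq;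
      [|apply Cderiv_plus; [now apply HF|apply Cderiv_scal, CInt_deriv, Hf]]. ring. }
  apply (Cderiv_zero (fun t => F t + (-(1)) * CInt f a t)); [easy| |].
  - intros x Hx. eapply Cderiv_cont, D, Hx.
  - intros x Hx. apply D. lra. }
rewrite CInt_point in E.
replace (CInt f a b) with (F b - (F b + (-(1)) * CInt f a b)) by ring.
rewrite <- E. ring.
Qed.

Lemma CInt_plus (f g : R -> C) (a b : R) : (a <= b)%R ->
  (forall x, Ccont f x) -> (forall x, Ccont g x) ->
  CInt (fun t => f t + g t) a b = CInt f a b + CInt g a b.
Proof.
intros Hab Hf Hg.
rewrite (CInt_FTC (fun t => CInt f a t + CInt g a t)), !CInt_point; [ring|easy| |].
- intros x. now apply Ccont_plus.
- intros x _. now apply Cderiv_plus; apply CInt_deriv.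
Qed.

Lemma CInt_scal (k : C) (f : R -> C) (a b : R) : (a <= b)%R ->
  (forall x, Ccont f x) -> CInt (fun t => k * f t) a b = k * CInt f a b.
Proof.
intros Hab Hf.
rewrite (CInt_FTC (fun t => k * CInt f a t)), !CInt_point; [ring|easy| |].
- intros x. apply Ccont_mult; [apply Ccont_const|apply Hf].
- intros x _. now apply Cderiv_scal, CInt_deriv.
Qed.

Lemma CInt_csum (n : nat) (f : nat -> R -> C) (a b : R) : (a <= b)%R ->
  (forall i x, Ccont (f i) x) ->
  CInt (fun t => csum n (fun i => f i t)) a b = csum n (fun i => CInt (f i) a b).
Proof.
intros Hab Hf.
rewrite (CInt_FTC (fun t => csum n (fun i => CInt (f i) a t))); [|easy| |].
- rewrite (csum_zero n (fun i => CInt (f i) a a)); [ring|].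
  intros i _. apply CInt_point.
- intros x. apply Ccont_csum. intros; apply Hf.
- intros x _. apply Cderiv_csum. intros i _. apply CInt_deriv, Hf.
Qed.

Lemma CInt_Chasles (f : R -> C) (a b c : R) : (forall x, Ccont f x) ->
  CInt f a b + CInt f b c = CInt f a c.
Proof.
intros Hf.
assert (E : forall u v, ex_RInt (V := C_R_CompleteNormedModule) f u v).
{ intros u v. exists (RInt (fun t => fst (f t)) u v, RInt (fun t => snd (f t)) u v).
  apply (is_RInt_fct_extend_pair (U := R_NormedModule) (V := R_NormedModule) f u v);
    apply (RInt_correct (V := R_CompleteNormedModule)), ex_RInt_continuous;
    intros x _; apply continuity_pt_filterlim; apply (Hf x). }
exact (RInt_Chasles (V := C_R_CompleteNormedModule) f a b c (E a b) (E b c)).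
Qed.

(** Matches the difference quotient in [derivX], up to the uniformity in [x] and the one-sided
    endpoints there. *)
Lemma Cderiv_quotient (f : R -> C) (x : R) (l : C) :
  Cderiv f x l <-> forall eps, (0 < eps)%R -> exists delta, (0 < delta)%R /\
    forall t, t <> 0%R -> (Rabs t < delta)%R ->
      (Cmod ((f (x + t)%R - f x) / RtoC t - l) < eps)%R.
Proof.
assert (Hq : forall t, t <> 0%R -> (f (x + t)%R - f x) / RtoC t - l =
  (((fst (f (x + t)%R) - fst (f x)) / t - fst l)%R,
   ((snd (f (x + t)%R) - snd (f x)) / t - snd l)%R)).
{ intros t Ht. unfold Cdiv. rewrite <- RtoC_inv by exact Ht.
  apply injective_projections; simpl; unfold Rdiv; ring. }
split.
- intros [F1 F2] eps Heps.
  destruct (F1 (eps / 2)%R ltac:(lra)) as [[d1 Hd1] G1].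
  destruct (F2 (eps / 2)%R ltac:(lra)) as [[d2 Hd2] G2]. simpl in G1, G2.
  exists (Rmin d1 d2). split; [now apply Rmin_glb_lt|]. intros t Ht Hy.
  pose proof (Rmin_l d1 d2). pose proof (Rmin_r d1 d2).
  specialize (G1 t Ht ltac:(lra)). specialize (G2 t Ht ltac:(lra)).
  rewrite Hq by easy.
  match goal with |- (Cmod (?p, ?q) < _)%R =>
    replace ((p, q) : C) with (RtoC p + Ci * RtoC q)
      by (apply injective_projections; simpl; ring) end.
  eapply Rle_lt_trans; [apply Cmod_triangle|].
  rewrite Cmod_mult, !Cmod_R, Cmod_Ci. lra.
- intros H. split; intros eps Heps; destruct (H eps Heps) as [d [Hd G]];
    exists (mkposreal d Hd); simpl; intros t Ht Hy; specialize (G t Ht Hy);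
    rewrite Hq in G by easy;
    eapply Rle_lt_trans; try exact G;
    (eapply Rle_trans; [|apply Rmax_Cmod]);
    [apply Rmax_l|apply Rmax_r].
Qed.

(** * Extension of functions on [[-1,1]] and [[-h,0]] to the whole line *)

(** For [a <= b], the nearest-point projection onto [[a,b]]. Composing with it gives a function
    continuous on all of R, as the integral lemmas require, without changing values on the
    interval. *)
Definition clamp (a b x : R) : R := Rmax a (Rmin b x).

Lemma clamp_range (a b x : R) : (a <= b)%R -> (a <= clamp a b x <= b)%R.
Proof.
intros H. unfold clamp. split; [apply Rmax_l|].
apply Rmax_lub; [easy|apply Rmin_l].
Qed.

Lemma clamp_id (a b x : R) : (a <= x <= b)%R -> clamp a b x = x.
Proof. intros H. unfold clamp. rewrite Rmin_right by lra. apply Rmax_right. lra. Qed.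

Lemma clamp_contract (a b x y : R) : (Rabs (clamp a b y - clamp a b x) <= Rabs (y - x))%R.
Proof.
unfold clamp, Rmax, Rmin. repeat destruct (Rle_dec _ _); unfold Rabs;
  repeat destruct (Rcase_abs _); lra.
Qed.

Lemma continuity_pt_eps (g : R -> R) (x : R) : continuity_pt g x ->
  forall eps, (0 < eps)%R -> exists delta, (0 < delta)%R /\
    forall y, (Rabs (y - x) < delta)%R -> (Rabs (g y - g x) < eps)%R.
Proof.
intros Hg eps Heps.
destruct (proj1 (Ccont_eps _ x) (Ccont_RtoC g x Hg) eps Heps) as [d [Hd G]].
exists d. split; [exact Hd|]. intros y Hy.
rewrite <- Cmod_R, RtoC_minus. now apply G.
Qed.

Lemma inY_Ccont (f : R -> C) (x : R) : inY f -> Ccont (fun t => f (clamp (-1) 1 t)) x.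
Proof.
intros Hf. apply Ccont_eps. intros eps Heps.
destruct (Hf (clamp (-1) 1 x) ltac:(apply clamp_range; lra) eps Heps) as [d [Hd G]].
exists d. split; [exact Hd|]. intros y Hy. apply G; [apply clamp_range; lra|].
eapply Rle_lt_trans; [apply clamp_contract|exact Hy].
Qed.

(** Joint continuity in both arguments: the modulus in [theta] is uniform in the space variable, and
    one fixed slice is continuous in space. *)
Lemma inX_Ccont (h : R) (phi : R -> R -> C) (th xi : R -> R) (x : R) :
  (0 <= h)%R -> inX h phi -> continuity_pt th x -> continuity_pt xi x ->
  Ccont (fun r => phi (clamp (-h) 0 (th r)) (clamp (-1) 1 (xi r))) x.
Proof.
intros Hh [HY HX] Hth Hxi. apply Ccont_eps. intros eps Heps.
assert (R0 : forall r, (-h <= clamp (-h) 0 r <= 0)%R) by (intros; apply clamp_range; lra).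
assert (R1 : forall r, (-1 <= clamp (-1) 1 r <= 1)%R) by (intros; apply clamp_range; lra).
destruct (HX _ (R0 (th x)) (eps / 2)%R ltac:(lra)) as [d1 [Hd1 G1]].
destruct (HY _ (R0 (th x)) _ (R1 (xi x)) (eps / 2)%R ltac:(lra)) as [d2 [Hd2 G2]].
destruct (continuity_pt_eps th x Hth d1 Hd1) as [e1 [He1 K1]].
destruct (continuity_pt_eps xi x Hxi d2 Hd2) as [e2 [He2 K2]].
exists (Rmin e1 e2). split; [now apply Rmin_glb_lt|]. intros y Hy.
pose proof (Rmin_l e1 e2). pose proof (Rmin_r e1 e2).
specialize (G1 _ (R0 (th y)) (Rle_lt_trans _ _ _ (clamp_contract _ _ _ _) (K1 y ltac:(lra)))
  _ (R1 (xi y))).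
specialize (G2 _ (R1 (xi y)) (Rle_lt_trans _ _ _ (clamp_contract _ _ _ _) (K2 y ltac:(lra)))).
(* The intermediate value has the old [theta] and the new space point, where [G1] and [G2] meet. *)
match goal with |- (Cmod (?p - ?q) < _)%R =>
  replace (p - q) with (p - phi (clamp (-h) 0 (th x)) (clamp (-1) 1 (xi y)) +
    (phi (clamp (-h) 0 (th x)) (clamp (-1) 1 (xi y)) - q)) by ring end.
eapply Rle_lt_trans; [apply Cmod_triangle|]. lra.
Qed.

(** * From the resolvent equation to an integral equation on [[-1,1]] *)

Lemma cexp_linear_cont (w : C) (x : R) : Ccont (fun t => cexp (w * RtoC t)) x.
Proof. eapply Cderiv_cont, Cderiv_cexp. Qed.

Lemma continuity_pt_id_fun (x : R) : continuity_pt (fun t => t) x.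
Proof. apply derivable_continuous_pt, derivable_pt_id. Qed.

Lemma continuity_pt_cst (a x : R) : continuity_pt (fun _ => a) x.
Proof. now apply continuity_pt_const; intros ? ?. Qed.

(* Variation of constants: [e^{-z t} psi(t) + int_th^t e^{-z s} phi(s) ds] is constant. *)
Lemma resolvent_solution_form (N : nat) (c mu : nat -> C) (tau0 alpha : R) (z : C)
  (phi psi : R -> R -> C) (th x : R) :
  (0 <= tau0)%R -> inX (hh tau0) phi -> solves_resolvent N c mu tau0 alpha z phi psi ->
  (- hh tau0 <= th <= 0)%R -> (-1 <= x <= 1)%R ->
  psi th x = resolvent_formula z (psi 0) phi th x.
Proof.
intros Htau Hphi [dpsi [[Hpsi [Hder [_ _]]] Heq]] Hth Hx.
assert (Hh : (0 <= hh tau0)%R) by (unfold hh; lra).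
set (f := fun t => psi (clamp (- hh tau0) 0 t) x).
set (g := fun s => cexp (- z * RtoC s) * phi (clamp (- hh tau0) 0 s) x).
assert (Cf : forall t, Ccont f t).
{ intros t. eapply Ccont_ext; [|apply (inX_Ccont (hh tau0) psi (fun s => s) (fun _ => x) t);
    [easy|easy|apply continuity_pt_id_fun|apply continuity_pt_cst]].
  intros s. unfold f. simpl. now rewrite (clamp_id (-1) 1 x). }
assert (Cg : forall t, Ccont g t).
{ intros t. apply Ccont_mult; [apply cexp_linear_cont|].
  eapply Ccont_ext; [|apply (inX_Ccont (hh tau0) phi (fun s => s) (fun _ => x) t);
    [easy|easy|apply continuity_pt_id_fun|apply continuity_pt_cst]].
  intros s. simpl. now rewrite (clamp_id (-1) 1 x). }
assert (E : cexp (- z * RtoC th) * f th + CInt g th th = cexp (- z * RtoC 0) * f 0%R + CInt g th 0).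
{ apply (Cderiv_zero (fun t => cexp (- z * RtoC t) * f t + CInt g th t)); [lra| |].
  - intros t _. apply Ccont_plus; [apply Ccont_mult; [apply cexp_linear_cont|apply Cf]|].
    eapply Cderiv_cont, CInt_deriv, Cg.
  - intros t Ht.
    assert (Df : Cderiv f t (dpsi t x)).
    { apply Cderiv_quotient. intros eps Heps.
      destruct (Hder t ltac:(lra) eps Heps) as [d [Hd G]].
      (* The extra bounds keep [t + s] inside [[-h,0]], where [clamp] is the identity and [derivX]
         applies. *)
      exists (Rmin d (Rmin (t + hh tau0) (- t))). split; [repeat apply Rmin_glb_lt; lra|].
      intros s Hs Hsd.
      pose proof (Rmin_l d (Rmin (t + hh tau0) (- t))).
      pose proof (Rmin_r d (Rmin (t + hh tau0) (- t))).
      pose proof (Rmin_l (t + hh tau0) (- t)). pose proof (Rmin_r (t + hh tau0) (- t)).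
      assert (Hts : (- hh tau0 <= t + s <= 0)%R).
      { revert Hsd. unfold Rabs. destruct (Rcase_abs s); intros; lra. }
      unfold f. rewrite !clamp_id by lra. apply G; [easy|lra|easy|easy]. }
    eapply Cderiv_eq; [|apply Cderiv_plus;
      [apply Cderiv_mult; [apply Cderiv_cexp|exact Df]|apply CInt_deriv, Cg]].
    unfold g, f. rewrite clamp_id by lra. rewrite <- (Heq t x) by lra. ring. }
rewrite CInt_point in E. unfold f in E. rewrite !clamp_id in E by lra.
rewrite Cmult_0_r, cexp_0 in E.
unfold resolvent_formula.
replace (CInt (fun s => cexp (z * RtoC (th - s)) * phi s x) th 0)
  with (cexp (z * RtoC th) * CInt g th 0).
- transitivity (cexp (z * RtoC th) * (cexp (- z * RtoC th) * psi th x + 0)).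
  + rewrite Cplus_0_r, Cmult_assoc, <- cexp_plus.
    replace (z * RtoC th + - z * RtoC th) with (RtoC 0) by ring. rewrite cexp_0. ring.
  + rewrite E. ring.
- rewrite <- CInt_scal by (try exact Cg; lra). apply CInt_ext; [lra|].
  intros s Hs. unfold g. rewrite clamp_id by lra.
  rewrite Cmult_assoc, <- cexp_plus. f_equal. f_equal. rewrite RtoC_minus. ring.
Qed.

Lemma Jc_cont (N : nat) (c mu : nat -> C) (x r : R) : Ccont (Jc N c mu x) r.
Proof.
apply (Ccont_csum N (fun i r => c i * cexp (- mu i * RtoC (Rabs (x - r))))).
intros i _. apply Ccont_mult; [apply Ccont_const|].
apply (Ccont_comp (fun r => Rabs (x - r)) (fun t => cexp (- mu i * RtoC t))).
- apply (continuity_pt_comp (fun r => (x - r)%R) Rabs); [|apply Rcontinuity_abs].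
  apply (continuity_pt_minus (fun _ => x) (fun r => r));
    [apply continuity_pt_cst|apply continuity_pt_id_fun].
- apply cexp_linear_cont.
Qed.

Lemma delay_cont (tau0 x r : R) : continuity_pt (fun r => (- tau0 - Rabs (x - r))%R) r.
Proof.
apply (continuity_pt_minus (fun _ => (- tau0)%R) (fun r => Rabs (x - r)));
  [apply continuity_pt_cst|].
apply (continuity_pt_comp (fun r => (x - r)%R) Rabs); [|apply Rcontinuity_abs].
apply (continuity_pt_minus (fun _ => x) (fun r => r));
  [apply continuity_pt_cst|apply continuity_pt_id_fun].
Qed.

Lemma delay_range (tau0 x r : R) : (0 <= tau0)%R -> (-1 <= x <= 1)%R -> (-1 <= r <= 1)%R ->
  (- hh tau0 <= - tau0 - Rabs (x - r) <= 0)%R.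
Proof. intros. unfold hh, Rabs. destruct (Rcase_abs (x - r)); lra. Qed.

(** At [theta = 0] the domain condition turns the resolvent equation into
    [(z + alpha) psi(0) - L psi = phi(0)]. By variation of constants, [L psi] is L applied to
    [e^{z theta} psi(0)] plus L applied to [H_z phi], and the latter is the double integral in
    [hz]. *)
Lemma resolvent_integral_equation (N : nat) (c mu : nat -> C) (tau0 alpha : R) (z : C)
  (phi psi : R -> R -> C) (x : R) :
  (0 <= tau0)%R -> inX (hh tau0) phi -> solves_resolvent N c mu tau0 alpha z phi psi ->
  (-1 <= x <= 1)%R ->
  (z + RtoC alpha) * psi 0%R x
    - Lop N c mu tau0 (fun th r => cexp (z * RtoC th) * psi 0%R r) x
  = hz N c mu tau0 z phi x.
Proof.
intros Htau Hphi Hsol Hx.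
assert (Hform := fun th r Hth Hr =>
  resolvent_solution_form N c mu tau0 alpha z phi psi th r Htau Hphi Hsol Hth Hr).
destruct Hsol as [dpsi [[Hpsi [_ [_ Hdom]]] Heq]].
assert (Hh : (0 <= hh tau0)%R) by (unfold hh; lra).
specialize (Hdom x Hx). specialize (Heq 0%R x ltac:(lra) Hx).
set (d := fun r => (- tau0 - Rabs (x - r))%R).
(* [P] and [Q] are the integrands of [L psi] and of L applied to [e^{z theta} psi(0)], extended
   continuously to the whole line. *)
set (P := fun r => Jc N c mu x r * psi (clamp (- hh tau0) 0 (d r)) (clamp (-1) 1 r)).
set (Q := fun r => Jc N c mu x r *
  (cexp (z * RtoC (d r)) * psi (clamp (- hh tau0) 0 0) (clamp (-1) 1 r))).
assert (CP : forall r, Ccont P r).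
{ intros r. apply Ccont_mult; [apply Jc_cont|].
  apply (inX_Ccont _ psi d (fun r => r)); [easy|easy|apply delay_cont|apply continuity_pt_id_fun]. }
assert (CQ : forall r, Ccont Q r).
{ intros r. apply Ccont_mult; [apply Jc_cont|]. apply Ccont_mult.
  - apply (Ccont_comp d (fun t => cexp (z * RtoC t))); [apply delay_cont|apply cexp_linear_cont].
  - apply (inX_Ccont _ psi (fun _ => 0%R) (fun r => r));
      [easy|easy|apply continuity_pt_cst|apply continuity_pt_id_fun]. }
assert (LP : Lop N c mu tau0 psi x = CInt P (-1) 1).
{ apply CInt_ext; [lra|]. intros r Hr. unfold P.
  rewrite !clamp_id; [reflexivity|easy|now apply delay_range]. }
assert (LQ : Lop N c mu tau0 (fun th r => cexp (z * RtoC th) * psi 0%R r) x = CInt Q (-1) 1).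
{ apply CInt_ext; [lra|]. intros r Hr. unfold Q.
  rewrite !clamp_id; [reflexivity|easy|lra]. }
assert (I : CInt (fun r => CInt (fun s => Jc N c mu x r *
      cexp (- z * RtoC (tau0 + s) - z * RtoC (Rabs (x - r))) * phi s r)
      (- tau0 - Rabs (x - r)) 0) (-1) 1 = CInt P (-1) 1 - CInt Q (-1) 1).
{ transitivity (CInt (fun r => P r + (-(1)) * Q r) (-1) 1).
  - apply CInt_ext; [lra|]. intros r Hr. unfold P, Q.
    assert (Hd : (- hh tau0 <= d r <= 0)%R) by now apply delay_range.
    rewrite !clamp_id by lra.
    set (g := fun s => cexp (z * RtoC (d r - s)) *
      phi (clamp (- hh tau0) 0 s) (clamp (-1) 1 r)).
    assert (Cg : forall s, Ccont g s).
    { intros s. apply Ccont_mult.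
      - apply (Ccont_comp (fun s => (d r - s)%R) (fun t => cexp (z * RtoC t)));
          [|apply cexp_linear_cont].
        apply (continuity_pt_minus (fun _ => d r) (fun s => s));
          [apply continuity_pt_cst|apply continuity_pt_id_fun].
      - apply (inX_Ccont _ phi (fun s => s) (fun _ => r));
          [easy|easy|apply continuity_pt_id_fun|apply continuity_pt_cst]. }
    (* The inner integral is [H_z phi] at the delayed time [d r]. *)
    assert (Eg : CInt g (d r) 0 = psi (d r) r - cexp (z * RtoC (d r)) * psi 0%R r).
    { rewrite (Hform (d r) r Hd Hr). unfold resolvent_formula.
      rewrite (CInt_ext g (fun s => cexp (z * RtoC (d r - s)) * phi s r)); [ring|lra|].
      intros s Hs. unfold g. now rewrite !clamp_id by lra. }
    transitivity (Jc N c mu x r * CInt g (d r) 0); [|rewrite Eg; ring].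
    rewrite <- CInt_scal by (try exact Cg; lra).
    apply CInt_ext; [exact (proj2 Hd)|].
    intros s Hs. change (d r <= s <= 0)%R in Hs. unfold g. rewrite !clamp_id by lra.
    rewrite Cmult_assoc. f_equal. f_equal. f_equal.
    unfold d. rewrite !RtoC_minus, RtoC_plus, RtoC_opp. ring.
  - rewrite CInt_plus, CInt_scal; [ring|lra|easy|lra|easy|].
    intros r. apply Ccont_mult; [apply Ccont_const|apply CQ]. }
unfold hz. rewrite I, <- Heq, Hdom, LP, LQ. ring.
Qed.

(** The delay factor [e^{-z|x-r|}] merges with [e^{-mu_j|x-r|}] into [e^{-k_j|x-r|}]. Splitting the
    integral at [r = x] resolves the absolute value, and each exponential then factors into a part
    in [x] and a part in [r]. *)
Lemma Lop_exponential_kernel (N : nat) (c mu : nat -> C) (tau0 : R) (z : C)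
  (Q : R -> C) (x : R) :
  (forall r, Ccont Q r) -> (-1 <= x <= 1)%R ->
  Lop N c mu tau0 (fun th r => cexp (z * RtoC th) * Q r) x =
  cexp (- z * RtoC tau0) * csum N (fun j => c j *
    (cexp (- kk mu z j * RtoC x) * CInt (fun r => cexp (kk mu z j * RtoC r) * Q r) (-1) x
     + cexp (kk mu z j * RtoC x) * CInt (fun r => cexp (- kk mu z j * RtoC r) * Q r) x 1)).
Proof.
intros CQ Hx. unfold Lop.
assert (Ce : forall j r, Ccont (fun r => cexp (- kk mu z j * RtoC (Rabs (x - r))) * Q r) r).
{ intros j r. apply Ccont_mult; [|apply CQ].
  apply (Ccont_comp (fun r => Rabs (x - r)) (fun t => cexp (- kk mu z j * RtoC t)));
    [|apply cexp_linear_cont].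
  apply (continuity_pt_comp (fun r => (x - r)%R) Rabs); [|apply Rcontinuity_abs].
  apply (continuity_pt_minus (fun _ => x) (fun r => r));
    [apply continuity_pt_cst|apply continuity_pt_id_fun]. }
transitivity (CInt (fun r => csum N (fun j => (cexp (- z * RtoC tau0) * c j) *
  (cexp (- kk mu z j * RtoC (Rabs (x - r))) * Q r))) (-1) 1).
{ apply CInt_ext; [lra|]. intros r _. unfold Jc.
  rewrite Cmult_comm, <- csum_scal. apply csum_ext. intros j _.
  replace (z * RtoC (- tau0 - Rabs (x - r))) with
    (- z * RtoC tau0 + - z * RtoC (Rabs (x - r)))
    by (rewrite RtoC_minus, RtoC_opp; ring).
  replace (- kk mu z j * RtoC (Rabs (x - r))) with
    (- z * RtoC (Rabs (x - r)) + - mu j * RtoC (Rabs (x - r))) by (unfold kk; ring).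
  rewrite !cexp_plus. ring. }
rewrite (CInt_csum N (fun j r => (cexp (- z * RtoC tau0) * c j) *
  (cexp (- kk mu z j * RtoC (Rabs (x - r))) * Q r))); [|lra|].
2:{ intros j r. apply Ccont_mult; [apply Ccont_const|apply Ce]. }
rewrite <- csum_scal. apply csum_ext. intros j _.
rewrite CInt_scal, <- Cmult_assoc by (try apply Ce; lra).
rewrite <- (CInt_Chasles _ (-1) x 1) by apply Ce.
do 3 f_equal.
- rewrite <- CInt_scal; [|lra|intros; apply Ccont_mult; [apply cexp_linear_cont|apply CQ]].
  apply CInt_ext; [lra|]. intros r Hr.
  rewrite Cmult_assoc, <- cexp_plus, Rabs_pos_eq by lra.
  do 2 f_equal. rewrite RtoC_minus. ring.
- rewrite <- CInt_scal; [|lra|intros; apply Ccont_mult; [apply cexp_linear_cont|apply CQ]].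
  apply CInt_ext; [lra|]. intros r Hr.
  rewrite Cmult_assoc, <- cexp_plus, Rabs_minus_sym, Rabs_pos_eq by lra.
  do 2 f_equal. rewrite RtoC_minus. ring.
Qed.

(** * The matrices T and S in terms of the signed roots *)

(** Indexing columns by the signed root [s_a] merges the left and right blocks: in T and S alike,
    row [j] has denominators [k_j - s_a] and row [N + j] has [k_j + s_a]. *)
Lemma Tm_top (N : nat) (mu : nat -> C) (z : C) (rho : nat -> C) (j a : nat) :
  (j < N)%nat -> Tm N mu z rho j a = / (kk mu z j - signed_root N rho a).
Proof.
intros Hj. unfold Tm, blk2, signed_root. apply Nat.ltb_lt in Hj as ->.
destruct (Nat.ltb a N); [reflexivity|]. f_equal. ring.
Qed.

Lemma Tm_bottom (N : nat) (mu : nat -> C) (z : C) (rho : nat -> C) (j a : nat) :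
  Tm N mu z rho (N + j) a = / (kk mu z j + signed_root N rho a).
Proof.
unfold Tm, blk2, signed_root.
replace (Nat.ltb (N + j) N) with false by (symmetry; apply Nat.ltb_ge; lia).
replace (N + j - N)%nat with j by lia.
destruct (Nat.ltb a N); reflexivity.
Qed.

Lemma Sm_top (N : nat) (mu : nat -> C) (z : C) (rho : nat -> C) (j a : nat) :
  (j < N)%nat ->
  Sm N mu z rho j a = cexp (signed_root N rho a) / (kk mu z j - signed_root N rho a).
Proof.
intros Hj. unfold Sm, blk2, signed_root, Sminus, Splus, kk. apply Nat.ltb_lt in Hj as ->.
destruct (Nat.ltb a N); [reflexivity|]. f_equal. ring.
Qed.

Lemma Sm_bottom (N : nat) (mu : nat -> C) (z : C) (rho : nat -> C) (j a : nat) :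
  Sm N mu z rho (N + j) a =
  cexp (- signed_root N rho a) / (kk mu z j + signed_root N rho a).
Proof.
unfold Sm, blk2, signed_root, Sminus, Splus, kk.
replace (Nat.ltb (N + j) N) with false by (symmetry; apply Nat.ltb_ge; lia).
replace (N + j - N)%nat with j by lia.
destruct (Nat.ltb a N); [reflexivity|]. f_equal. f_equal. ring.
Qed.

(** The stacked vector holds the values at [1] and at [-1]. The upper rows of S impose the boundary
    condition at [1], the lower rows the one at [-1]. *)
Lemma Sbig_top (N : nat) (mu : nat -> C) (z : C) (rho : nat -> C) (u v : nat -> C) (j : nat) :
  (j < N)%nat ->
  mvec (4 * N) (Sbig N mu z rho)
    (fun b => if Nat.ltb b (2 * N) then u b else v (b - 2 * N)%nat) j
  = mvec (2 * N) (Sm N mu z rho) u j.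
Proof.
intros Hj. unfold mvec. replace (4 * N)%nat with (2 * N + 2 * N)%nat by lia.
rewrite csum_split. match goal with |- _ + ?B = _ => replace B with (RtoC 0) end.
- rewrite Cplus_0_r. apply csum_ext. intros a Ha. unfold Sbig, Sm, blk2.
  apply Nat.ltb_lt in Hj as ->. apply Nat.ltb_lt in Ha as ->. reflexivity.
- symmetry. apply csum_zero. intros a Ha. unfold Sbig. apply Nat.ltb_lt in Hj as ->.
  replace (Nat.ltb (2 * N + a) N) with false by (symmetry; apply Nat.ltb_ge; lia).
  replace (Nat.ltb (2 * N + a) (2 * N)) with false by (symmetry; apply Nat.ltb_ge; lia).
  ring.
Qed.

Lemma Sbig_bottom (N : nat) (mu : nat -> C) (z : C) (rho : nat -> C) (u v : nat -> C)
  (j : nat) :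
  mvec (4 * N) (Sbig N mu z rho)
    (fun b => if Nat.ltb b (2 * N) then u b else v (b - 2 * N)%nat) (N + j)
  = mvec (2 * N) (Sm N mu z rho) v (N + j).
Proof.
unfold mvec. replace (4 * N)%nat with (2 * N + 2 * N)%nat by lia.
assert (Hj : Nat.ltb (N + j) N = false) by (apply Nat.ltb_ge; lia).
rewrite csum_split, (csum_zero (2 * N)).
- rewrite Cplus_0_l. apply csum_ext. intros a Ha. unfold Sbig, Sm, blk2. rewrite Hj.
  replace (Nat.ltb (2 * N + a) (2 * N)) with false by (symmetry; apply Nat.ltb_ge; lia).
  replace (2 * N + a - 2 * N)%nat with a by lia.
  destruct (Nat.ltb_spec a N).
  + replace (Nat.ltb (2 * N + a) (3 * N)) with true by (symmetry; apply Nat.ltb_lt; lia).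
    reflexivity.
  + replace (Nat.ltb (2 * N + a) (3 * N)) with false by (symmetry; apply Nat.ltb_ge; lia).
    replace (2 * N + a - 3 * N)%nat with (a - N)%nat by lia. reflexivity.
- intros a Ha. unfold Sbig. rewrite Hj. apply Nat.ltb_lt in Ha as ->. ring.
Qed.

(** * The characteristic polynomial in partial fractions *)

Lemma cprod_ext (n : nat) (f g : nat -> C) :
  (forall i, (i < n)%nat -> f i = g i) -> cprod n f = cprod n g.
Proof.
induction n as [|n IH]; simpl; intros Hfg; [reflexivity|].
rewrite IH by (intros; apply Hfg; lia). now rewrite Hfg by lia.
Qed.

Lemma cprod_remove (n i : nat) (f : nat -> C) : (i < n)%nat ->
  cprod n f = f i * cprod n (fun j => if Nat.eqb j i then RtoC 1 else f j).
Proof.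
induction n as [|n IH]; intros Hi; [lia|]. simpl.
destruct (Nat.eq_dec i n) as [->|Hin].
- rewrite Nat.eqb_refl, (cprod_ext n (fun j => if Nat.eqb j n then _ else _) f); [ring|].
  intros j Hj. now replace (Nat.eqb j n) with false by (symmetry; apply Nat.eqb_neq; lia).
- rewrite IH by lia.
  replace (Nat.eqb n i) with false by (symmetry; apply Nat.eqb_neq; lia). ring.
Qed.

Lemma cprod_neq_0 (n : nat) (f : nat -> C) :
  (forall i, (i < n)%nat -> f i <> 0) -> cprod n f <> 0.
Proof.
induction n as [|n IH]; simpl; intros H; [apply C1_nz|].
apply Cmult_neq_0; [apply IH; intros; apply H; lia|apply H; lia].
Qed.

(* [charP w] divided by [prod_j (w^2 - k_j^2)]. *)
Lemma charP_partial_fractions (N : nat) (c mu : nat -> C) (tau0 alpha : R) (z w : C) :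
  (forall j, (j < N)%nat -> kk mu z j - w <> 0 /\ kk mu z j + w <> 0) ->
  charP N c mu tau0 alpha z w = 0 ->
  csum N (fun j => c j * (/ (kk mu z j + w) + / (kk mu z j - w)))
  = cexp (z * RtoC tau0) * (z + RtoC alpha).
Proof.
intros Hk HP.
set (p := cprod N (fun j => w * w - kk mu z j * kk mu z j)).
assert (Hp : p <> 0).
{ apply cprod_neq_0. intros j Hj. destruct (Hk j Hj) as [H1 H2].
  replace (w * w - kk mu z j * kk mu z j)
    with (- (1) * ((kk mu z j - w) * (kk mu z j + w))) by ring.
  apply Cmult_neq_0; [|now apply Cmult_neq_0].
  intros H. apply (f_equal fst) in H. simpl in H. lra. }
unfold charP in HP. fold p in HP.
(* Uses [k / (w^2 - k^2) = -(1/2) (1/(k + w) + 1/(k - w))]. *)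
rewrite (csum_ext N _ (fun j => (- (RtoC (1 / 2)) * p) *
  (c j * (/ (kk mu z j + w) + / (kk mu z j - w))))), csum_scal in HP.
- assert (H2 : RtoC (1 / 2) <> 0) by (intros H; apply (f_equal fst) in H; simpl in H; lra).
  set (s := csum N _) in *.
  transitivity (cexp (z * RtoC tau0) * (z + RtoC alpha)
    - (RtoC (1 / 2) * cexp (z * RtoC tau0) * (z + RtoC alpha) * p + - RtoC (1 / 2) * p * s)
      / (RtoC (1 / 2) * p)).
  + field. now split.
  + rewrite HP. field. now split.
- intros j Hj. destruct (Hk j Hj) as [H1 H2]. unfold p.
  rewrite (cprod_remove N j (fun j => w * w - kk mu z j * kk mu z j) Hj).
  set (p' := cprod N (fun i => if Nat.eqb i j then _ else _)).
  transitivity (RtoC (1 / 2) * (1 + 1) * (c j * kk mu z j * p')).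
  + replace (RtoC (1 / 2) * (1 + 1)) with (RtoC 1)
      by (apply injective_projections; simpl; field).
    ring.
  + field. now split.
Qed.

(** * The exponential ansatz and its image under the integral operator *)

(** Differentiating [gam_i e^{(k + s_i) r} / (k + s_i)] yields [e^{k r} G w_i / (k + s_i)] plus
    [e^{k r} gam_i e^{s_i r}]. The normalization of [w] makes the coefficients of [G] add up to one.
    It is used with [k = k_j] and [k = -k_j]. *)
Lemma ansatz_primitive (n : nat) (sg w : nat -> C) (gam : nat -> R -> C) (G : R -> C)
  (k : C) (a b : R) :
  (a <= b)%R -> (forall r, Ccont G r) ->
  (forall i r, (i < n)%nat -> Cderiv (gam i) r (G r * (w i * cexp (- sg i * RtoC r)))) ->
  (forall i, (i < n)%nat -> k + sg i <> 0) ->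
  csum n (fun i => w i / (k + sg i)) = 1 ->
  CInt (fun r => cexp (k * RtoC r) *
    (G r + csum n (fun i => gam i r * cexp (sg i * RtoC r)))) a b =
  csum n (fun i => gam i b * cexp ((k + sg i) * RtoC b) / (k + sg i)) -
  csum n (fun i => gam i a * cexp ((k + sg i) * RtoC a) / (k + sg i)).
Proof.
intros Hab CG Dg Hk Hw.
apply (CInt_FTC (fun r => csum n (fun i =>
  gam i r * cexp ((k + sg i) * RtoC r) / (k + sg i)))); [easy| |].
- intros r. apply Ccont_mult; [apply cexp_linear_cont|].
  apply Ccont_plus; [apply CG|].
  apply (Ccont_csum n (fun i r => gam i r * cexp (sg i * RtoC r))).
  intros i Hi. apply Ccont_mult; [|apply cexp_linear_cont].
  eapply Cderiv_cont, Dg, Hi.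
- intros r _. eapply Cderiv_eq; cycle 1.
  + apply (Cderiv_csum n (fun i r => gam i r * cexp ((k + sg i) * RtoC r) * / (k + sg i))).
    intros i Hi. apply Cderiv_mult; [|apply Cderiv_const].
    apply Cderiv_mult; [apply (Dg i r Hi)|apply Cderiv_cexp].
  + transitivity (csum n (fun i => cexp (k * RtoC r) * G r * (w i / (k + sg i))
      + cexp (k * RtoC r) * (gam i r * cexp (sg i * RtoC r)))).
    * apply csum_ext. intros i Hi. specialize (Hk i Hi).
      replace ((k + sg i) * RtoC r) with (k * RtoC r + sg i * RtoC r) by ring.
      rewrite cexp_plus.
      replace (- sg i * RtoC r) with (- (sg i * RtoC r)) by ring.
      transitivity (cexp (k * RtoC r) * G r * (w i / (k + sg i)) *
          (cexp (- (sg i * RtoC r)) * cexp (sg i * RtoC r))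
        + cexp (k * RtoC r) * (gam i r * cexp (sg i * RtoC r))).
      -- field. exact Hk.
      -- rewrite cexp_opp. ring.
    * rewrite csum_plus, !csum_scal, Hw. ring.
Qed.

(** The operator returns [z + alpha] times the exponential sum alone, so the full ansatz solves the
    integral equation with right-hand side [(z + alpha) G]. Taking [G = 0] and constant [gam] covers
    the homogeneous case. *)
Lemma ansatz_solves (N : nat) (c mu : nat -> C) (tau0 alpha : R) (z : C)
  (rho w : nat -> C) (gam : nat -> R -> C) (G : R -> C) (x : R) :
  (forall a, (a < 2 * N)%nat -> charP N c mu tau0 alpha z (signed_root N rho a) = 0) ->
  (forall j a, (j < N)%nat -> (a < 2 * N)%nat ->
     kk mu z j - signed_root N rho a <> 0 /\ kk mu z j + signed_root N rho a <> 0) ->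
  (forall i, (i < 2 * N)%nat -> mvec (2 * N) (Tm N mu z rho) w i = pm_ones N i) ->
  (forall r, Ccont G r) ->
  (forall a r, (a < 2 * N)%nat ->
     Cderiv (gam a) r (G r * (w a * cexp (- signed_root N rho a * RtoC r)))) ->
  (forall j, (j < N)%nat -> mvec (2 * N) (Sm N mu z rho) (fun a => gam a 1%R) j = 0) ->
  (forall j, (j < N)%nat ->
     mvec (2 * N) (Sm N mu z rho) (fun a => gam a (-1)%R) (N + j) = 0) ->
  (-1 <= x <= 1)%R ->
  Lop N c mu tau0 (fun th r => cexp (z * RtoC th) *
    (G r + csum (2 * N) (fun a => gam a r * cexp (signed_root N rho a * RtoC r)))) x =
  (z + RtoC alpha) * csum (2 * N) (fun a => gam a x * cexp (signed_root N rho a * RtoC x)).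
Proof.
intros HP Hk HT CG Dg B1 B2 Hx. set (s := signed_root N rho) in *.
rewrite Lop_exponential_kernel; [|clear x Hx; intros x|easy].
2:{ apply Ccont_plus; [apply CG|].
  apply (Ccont_csum (2 * N) (fun a r => gam a r * cexp (s a * RtoC r))).
  intros a Ha. apply Ccont_mult; [|apply cexp_linear_cont]. eapply Cderiv_cont, Dg, Ha. }
(* What remains once the boundary terms at [1] and [-1] are gone: both one-sided integrals
   contribute only their value at [x]. *)
transitivity (cexp (- z * RtoC tau0) * csum N (fun j => csum (2 * N) (fun a =>
  (gam a x * cexp (s a * RtoC x)) * (c j * (/ (kk mu z j + s a) + / (kk mu z j - s a)))))).
- f_equal. apply csum_ext. intros j Hj.
  rewrite (ansatz_primitive (2 * N) s w gam G (kk mu z j)); [|lra|easy|easy| |].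
  2:{ intros a Ha. now apply Hk. }
  (* Row [N + j] of [T w = (-1, 1)] is the normalization for the exponent [k_j]. *)
  2:{ specialize (HT (N + j)%nat ltac:(lia)). unfold pm_ones in HT.
      replace (Nat.ltb (N + j) N) with false in HT by (symmetry; apply Nat.ltb_ge; lia).
      rewrite <- HT. apply csum_ext. intros a Ha. rewrite Tm_bottom. apply Cmult_comm. }
  rewrite (ansatz_primitive (2 * N) s w gam G (- kk mu z j)); [|lra|easy|easy| |].
  2:{ intros a Ha H. apply (proj1 (Hk j a Hj Ha)).
      replace (kk mu z j - s a) with (- (- kk mu z j + s a)) by ring. rewrite H. ring. }
  (* Row [j], with entry [-1], gives the normalization for [-k_j] after a change of sign. *)
  2:{ specialize (HT j ltac:(lia)). unfold pm_ones in HT.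
      replace (Nat.ltb j N) with true in HT by (symmetry; apply Nat.ltb_lt; lia).
      transitivity ((-(1)) * mvec (2 * N) (Tm N mu z rho) w j);
        [|rewrite HT; apply injective_projections; simpl; ring].
      unfold mvec. rewrite <- csum_scal. apply csum_ext. intros a Ha.
      rewrite Tm_top by easy. fold s. field. destruct (Hk j a Hj Ha) as [H1 _].
      split; [exact H1|]. intros H. apply H1.
      replace (kk mu z j - s a) with (- (- kk mu z j + s a)) by ring. rewrite H. ring. }
  (* The lower limit [-1] produces [e^{-k_j}] times row [N + j] of S applied to [gam(-1)], which is
     zero by [B2]. *)
  rewrite (csum_ext (2 * N) (fun i => gam i (-1)%R * _ / _) (fun a =>
    cexp (- kk mu z j) * (Sm N mu z rho (N + j) a * gam a (-1)%R))).
  2:{ intros a Ha. rewrite Sm_bottom. fold s.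
      replace ((kk mu z j + s a) * RtoC (-1)) with (- kk mu z j + - s a)
        by (apply injective_projections; simpl; ring).
      rewrite cexp_plus. field. now apply Hk. }
  rewrite csum_scal. specialize (B2 j Hj). unfold mvec in B2. rewrite B2.
  (* Likewise the upper limit [1] produces [-e^{-k_j}] times row [j] of S applied to [gam(1)], zero
     by [B1]. *)
  rewrite (csum_ext (2 * N) (fun i => gam i 1%R * _ / _) (fun a =>
    (- cexp (- kk mu z j)) * (Sm N mu z rho j a * gam a 1%R))).
  2:{ intros a Ha. rewrite Sm_top by easy. fold s.
      rewrite Cmult_1_r, cexp_plus. destruct (Hk j a Hj Ha) as [H1 _]. field.
      split; [exact H1|]. intros H. apply H1.
      replace (kk mu z j - s a) with (- (- kk mu z j + s a)) by ring. rewrite H. ring. }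
  rewrite csum_scal. specialize (B1 j Hj). unfold mvec in B1. rewrite B1.
  match goal with |- c j * (?e1 * (?A - ?y) + ?e2 * (?y' - ?B)) = _ =>
    transitivity (c j * e1 * A + (- c j * e2) * B); [ring|] end.
  rewrite <- !csum_scal, <- csum_plus. apply csum_ext. intros a Ha.
  replace ((kk mu z j + s a) * RtoC x) with (kk mu z j * RtoC x + s a * RtoC x) by ring.
  replace ((- kk mu z j + s a) * RtoC x) with (- (kk mu z j * RtoC x) + s a * RtoC x) by ring.
  replace (- kk mu z j * RtoC x) with (- (kk mu z j * RtoC x)) by ring.
  rewrite !cexp_plus. destruct (Hk j a Hj Ha) as [H1 H2].
  transitivity ((gam a x * cexp (s a * RtoC x)) *
    (c j * (/ (kk mu z j + s a) + / (kk mu z j - s a))) *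
    (cexp (- (kk mu z j * RtoC x)) * cexp (kk mu z j * RtoC x))); [|rewrite cexp_opp; ring].
  field. split; [exact H1|]. split; [exact H2|]. intros H. apply H1.
  replace (kk mu z j - s a) with (- (- kk mu z j + s a)) by ring. rewrite H. ring.
(* For each root [s_a] the sum over [j] is now the partial-fraction form of [charP] at a zero. *)
- rewrite csum_exchange, <- !csum_scal. apply csum_ext. intros a Ha. rewrite csum_scal.
  rewrite (charP_partial_fractions N c mu tau0 alpha z (s a));
    [|intros j Hj; now apply Hk|now apply HP].
  transitivity ((cexp (- (z * RtoC tau0)) * cexp (z * RtoC tau0)) *
    ((z + RtoC alpha) * (gam a x * cexp (s a * RtoC x)))); [|rewrite cexp_opp; ring].
  replace (- z * RtoC tau0) with (- (z * RtoC tau0)) by ring. ring.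
Qed.

(** * Uniqueness for the homogeneous integral equation *)

Lemma Ccont_bounded (f : R -> C) (a b : R) : (a <= b)%R -> (forall x, Ccont f x) ->
  exists M, (0 < M)%R /\ forall x, (a <= x <= b)%R -> (Cmod (f x) <= M)%R.
Proof.
intros Hab Hf.
assert (Hb : forall g : R -> R, (forall x, continuity_pt g x) ->
  exists M, forall x, (a <= x <= b)%R -> (Rabs (g x) <= M)%R).
{ intros g Hg. destruct (continuity_ab_maj (fun x => Rabs (g x)) a b Hab) as [m [Hm _]].
  - intros x _. apply (continuity_pt_comp g Rabs); [apply Hg|apply Rcontinuity_abs].
  - now exists (Rabs (g m)). }
destruct (Hb (fun x => fst (f x))) as [M1 H1]; [apply Hf|].
destruct (Hb (fun x => snd (f x))) as [M2 H2]; [apply Hf|].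
exists (Rabs M1 + Rabs M2 + 1)%R. split.
- pose proof (Rabs_pos M1). pose proof (Rabs_pos M2). lra.
- intros x Hx. specialize (H1 x Hx). specialize (H2 x Hx). cbv beta in H1, H2.
  pose proof (Rle_abs M1). pose proof (Rle_abs M2).
  replace (f x) with (RtoC (fst (f x)) + Ci * RtoC (snd (f x)))
    by (apply injective_projections; simpl; ring).
  eapply Rle_trans; [apply Cmod_triangle|].
  rewrite Cmod_mult, !Cmod_R, Cmod_Ci. lra.
Qed.

(** A bound [M] for [d] on [[-1,1]] makes continuity in [theta] uniform in the space variable, hence
    the tolerance [eps / M]. *)
Lemma exponential_inX (h : R) (w : C) (d : R -> C) :
  (forall x, Ccont d x) -> inX h (fun th x => cexp (w * RtoC th) * d x).
Proof.
intros Cd. destruct (Ccont_bounded d (-1) 1 ltac:(lra) Cd) as [M [HM Hd]]. split.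
- intros th _ x _ eps Heps.
  assert (Cx : Ccont (fun x => cexp (w * RtoC th) * d x) x)
    by (apply Ccont_mult; [apply Ccont_const|apply Cd]).
  destruct (proj1 (Ccont_eps _ _) Cx eps Heps) as [e [He G]].
  exists e. split; [exact He|]. intros y _ Hy. now apply G.
- intros th _ eps Heps.
  destruct (proj1 (Ccont_eps _ _) (cexp_linear_cont w th) (eps / M)%R) as [e [He G]];
    [now apply Rdiv_lt_0_compat|].
  exists e. split; [exact He|]. intros th' _ Hth x Hx. specialize (G th' Hth).
  replace (cexp (w * RtoC th') * d x - cexp (w * RtoC th) * d x)
    with ((cexp (w * RtoC th') - cexp (w * RtoC th)) * d x) by ring.
  rewrite Cmod_mult. apply Rle_lt_trans with
    (Cmod (cexp (w * RtoC th') - cexp (w * RtoC th)) * M)%R.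
  + apply Rmult_le_compat_l; [apply Cmod_ge_0|now apply Hd].
  + apply (Rmult_lt_compat_r M) in G; [|exact HM].
    unfold Rdiv in G. rewrite Rmult_assoc, Rinv_l, Rmult_1_r in G; lra.
Qed.

Lemma exponential_derivX (h : R) (w : C) (d : R -> C) :
  (forall x, Ccont d x) ->
  derivX h (fun th x => cexp (w * RtoC th) * d x)
           (fun th x => cexp (w * RtoC th) * (w * d x)).
Proof.
intros Cd. destruct (Ccont_bounded d (-1) 1 ltac:(lra) Cd) as [M [HM Hd]].
intros th _ eps Heps.
destruct (proj1 (Cderiv_quotient _ _ _) (Cderiv_cexp w th) (eps / M)%R) as [e [He G]];
  [now apply Rdiv_lt_0_compat|].
exists e. split; [exact He|]. intros t Ht Hte _ x Hx. specialize (G t Ht Hte).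
match goal with |- (Cmod ?E < _)%R =>
  replace E with (((cexp (w * RtoC (th + t)) - cexp (w * RtoC th)) / RtoC t
    - w * cexp (w * RtoC th)) * d x) by (unfold Cdiv; ring) end.
rewrite Cmod_mult.
eapply Rle_lt_trans; [apply Rmult_le_compat_l; [apply Cmod_ge_0|now apply Hd]|].
apply (Rmult_lt_compat_r M) in G; [|exact HM].
unfold Rdiv in G. rewrite Rmult_assoc, Rinv_l, Rmult_1_r in G; lra.
Qed.

(* [theta |-> e^{z theta} d] solves the resolvent equation with right-hand side [0]. *)
Lemma homogeneous_zero (N : nat) (c mu : nat -> C) (tau0 alpha : R) (z : C) (d : R -> C) :
  (0 <= tau0)%R -> in_resolvent_set N c mu tau0 alpha z -> (forall x, Ccont d x) ->
  (forall x, (-1 <= x <= 1)%R ->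
     Lop N c mu tau0 (fun th r => cexp (z * RtoC th) * d r) x = (z + RtoC alpha) * d x) ->
  forall x, (-1 <= x <= 1)%R -> d x = 0.
Proof.
intros Htau [_ [Huniq _]] Cd Hd x Hx.
assert (C0 : forall y, Ccont (fun _ : R => RtoC 0) y) by (intros; apply Ccont_const).
assert (Czd : forall k y, Ccont (fun y => k * d y) y)
  by (intros; apply Ccont_mult; [apply Ccont_const|apply Cd]).
(* The competing solution is zero, written as [cexp (z * RtoC th) * 0] so that the lemmas on
   exponentials serve for both; the two are compared at [theta = 0]. *)
assert (E : cexp (z * RtoC 0) * d x = cexp (z * RtoC 0) * 0).
{ apply (Huniq (fun _ _ => RtoC 0) (fun th x => cexp (z * RtoC th) * d x)
    (fun th x => cexp (z * RtoC th) * 0)); [| |unfold hh; lra|exact Hx].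
  - exists (fun th x => cexp (z * RtoC th) * (z * d x)). split; [|intros; ring].
    split; [now apply exponential_inX|]. split; [now apply exponential_derivX|].
    split; [apply (exponential_inX _ z (fun x => z * d x)), Czd|].
    intros y Hy. rewrite Hd by exact Hy. rewrite Cmult_0_r, cexp_0. ring.
  - exists (fun th x => cexp (z * RtoC th) * (z * 0)). split; [|intros; ring].
    split; [now apply (exponential_inX _ z (fun _ => RtoC 0))|].
    split; [now apply (exponential_derivX _ z (fun _ => RtoC 0))|].
    split; [apply (exponential_inX _ z (fun _ => z * 0)); intros; apply Ccont_const|].
    intros y Hy. unfold Lop.
    rewrite (CInt_ext _ (fun _ => 0 * RtoC 0)), CInt_scal; [ring|lra|easy|lra|].
    intros; ring. }
rewrite Cmult_0_r, cexp_0 in E.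
replace (d x) with (1 * d x) by ring. rewrite E. ring.
Qed.

(** * Independence of exponentials and invertibility of S *)

Lemma Cderiv_unique (f : R -> C) (x : R) (l m : C) :
  Cderiv f x l -> Cderiv f x m -> l = m.
Proof.
intros [F1 F2] [G1 G2].
apply injective_projections; eapply uniqueness_limite; eassumption.
Qed.

Lemma Cderiv_locally_zero (f : R -> C) (a b x : R) (l : C) :
  (a < x < b)%R -> (forall y, (a < y < b)%R -> f y = 0) -> Cderiv f x l -> l = 0.
Proof.
intros Hx Hf Df. apply (Cderiv_unique f x _ _ Df). apply Cderiv_quotient.
intros eps Heps. exists (Rmin (x - a) (b - x)). split; [apply Rmin_glb_lt; lra|].
intros t Ht Htd.
pose proof (Rmin_l (x - a) (b - x)). pose proof (Rmin_r (x - a) (b - x)).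
assert (Hxt : (a < x + t < b)%R)
  by (revert Htd; unfold Rabs; destruct (Rcase_abs t); intros; lra).
rewrite (Hf (x + t)%R Hxt), (Hf x Hx).
replace ((0 - 0) / RtoC t - 0) with (RtoC 0) by (unfold Cdiv; ring).
now rewrite Cmod_0.
Qed.

(** Multiplying by [e^{-s_n x}] and differentiating removes the last term and leaves distinct
    exponents [s_i - s_n]. Induction gives [v_i (s_i - s_n) = 0], and the last coefficient follows
    by evaluating at the midpoint. *)
Lemma exponentials_independent (n : nat) : forall (v s : nat -> C) (a b : R),
  (a < b)%R -> (forall i j, (i < n)%nat -> (j < n)%nat -> i <> j -> s i <> s j) ->
  (forall x, (a < x < b)%R -> csum n (fun i => v i * cexp (s i * RtoC x)) = 0) ->
  forall i, (i < n)%nat -> v i = 0.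
Proof.
induction n as [|n IH]; intros v s a b Hab Hs Hv; [intros; lia|].
assert (Hfirst : forall i, (i < n)%nat -> v i = 0).
{ assert (Hn : forall i, (i < n)%nat -> v i * (s i - s n) = 0).
  { apply (IH (fun i => v i * (s i - s n)) (fun i => s i - s n) a b Hab).
    - intros i j Hi Hj Hij E. apply (Hs i j); [lia|lia|exact Hij|].
      replace (s i) with (s i - s n + s n) by ring. rewrite E. ring.
    - intros x Hx.
      apply (Cderiv_locally_zero
        (fun y => csum n (fun i => v i * cexp ((s i - s n) * RtoC y)) + v n) a b x _ Hx).
      + intros y Hy. transitivity (cexp (- (s n * RtoC y)) *
          csum (S n) (fun i => v i * cexp (s i * RtoC y))).
        * simpl. rewrite Cmult_plus_distr_l, <- csum_scal. f_equal.
          -- apply csum_ext. intros i Hi.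
             replace ((s i - s n) * RtoC y) with (- (s n * RtoC y) + s i * RtoC y) by ring.
             rewrite cexp_plus. ring.
          -- transitivity (v n * (cexp (- (s n * RtoC y)) * cexp (s n * RtoC y)));
               [rewrite cexp_opp; ring|ring].
        * rewrite Hv by exact Hy. ring.
      + eapply Cderiv_eq; [|apply Cderiv_plus; [|apply Cderiv_const];
          apply (Cderiv_csum n (fun i y => v i * cexp ((s i - s n) * RtoC y)));
          intros i Hi; apply Cderiv_scal, Cderiv_cexp].
        rewrite Cplus_0_r. apply csum_ext. intros; ring. }
  intros i Hi. destruct (Ceq_dec (v i) 0) as [E|E]; [exact E|exfalso].
  apply (Cmult_neq_0 (v i) (s i - s n)); [exact E| |now apply Hn].
  intros E'. apply (Hs i n); [lia|lia|lia|].
  replace (s i) with (s i - s n + s n) by ring. rewrite E'. ring. }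
intros i Hi. destruct (Nat.eq_dec i n) as [->|Hin]; [|apply Hfirst; lia].
assert (Hm : (a < (a + b) / 2 < b)%R) by lra.
specialize (Hv _ Hm). simpl in Hv.
rewrite csum_zero in Hv by (intros k Hk; rewrite Hfirst by exact Hk; ring).
rewrite Cplus_0_l in Hv.
destruct (Ceq_dec (v n) 0) as [E|E]; [exact E|exfalso].
apply (Cmult_neq_0 _ _ E (cexp_neq_0 (s n * RtoC ((a + b) / 2))) Hv).
Qed.

(* If [z = - alpha], the row [(c, c)] is a left null vector of [T]. *)
Lemma z_plus_alpha_neq_0 (N : nat) (c mu : nat -> C) (tau0 alpha : R) (z : C)
  (rho : nat -> C) (Tinv : nat -> nat -> C) :
  (forall i, (i < N)%nat -> c i <> 0) ->
  charP N c mu tau0 alpha z 0 <> 0 \/ (0 < N)%nat ->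
  (forall a, (a < 2 * N)%nat -> charP N c mu tau0 alpha z (signed_root N rho a) = 0) ->
  (forall j a, (j < N)%nat -> (a < 2 * N)%nat ->
     kk mu z j - signed_root N rho a <> 0 /\ kk mu z j + signed_root N rho a <> 0) ->
  is_inverse (2 * N) (Tm N mu z rho) Tinv ->
  z + RtoC alpha <> 0.
Proof.
intros Hc HN HP Hk HT E.
(* Without any row, [charP] is the constant [(1/2) e^{z tau0} (z + alpha)], assumed nonzero in
   [HN]. *)
destruct (Nat.eq_dec N 0) as [->|HN0].
{ destruct HN as [HN|HN]; [|lia]. apply HN. unfold charP. simpl. rewrite E. ring. }
set (u := fun i => if Nat.ltb i N then c i else c (i - N)%nat).
assert (Hu : forall a, (a < 2 * N)%nat -> csum (2 * N) (fun i => u i * Tm N mu z rho i a) = 0).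
{ intros a Ha. rewrite csum_double.
  transitivity (cexp (z * RtoC tau0) * (z + RtoC alpha)); [|rewrite E; ring].
  rewrite <- (charP_partial_fractions N c mu tau0 alpha z (signed_root N rho a));
    [|intros j Hj; now apply Hk|now apply HP].
  apply csum_ext. intros j Hj. unfold u. rewrite Tm_top, Tm_bottom by exact Hj.
  replace (Nat.ltb (N + j) N) with false by (symmetry; apply Nat.ltb_ge; lia).
  replace (N + j - N)%nat with j by lia. apply Nat.ltb_lt in Hj as ->. ring. }
apply (Hc 0%nat ltac:(lia)). transitivity (u 0%nat).
{ unfold u. replace (Nat.ltb 0 N) with true by (symmetry; apply Nat.ltb_lt; lia). reflexivity. }
rewrite <- (csum_kron (2 * N) 0 u) by lia.
(* Entry [0] of [u = u T Tinv] vanishes because [u T = 0], although it equals [c 0]. *)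
transitivity (csum (2 * N) (fun i => csum (2 * N) (fun a =>
  u i * (Tm N mu z rho i a * Tinv a 0%nat)))).
- apply csum_ext. intros i Hi. rewrite csum_scal.
  change (csum (2 * N) (fun a => Tm N mu z rho i a * Tinv a 0%nat))
    with (mmul (2 * N) (Tm N mu z rho) Tinv i 0%nat).
  rewrite (proj1 (HT i 0%nat Hi ltac:(lia))). unfold kron.
  rewrite (Nat.eqb_sym 0 i). ring.
- rewrite csum_exchange. apply csum_zero. intros a Ha.
  rewrite (csum_ext _ _ (fun i => Tinv a 0%nat * (u i * Tm N mu z rho i a)))
    by (intros; ring).
  rewrite csum_scal, Hu by exact Ha. ring.
Qed.

(** A kernel vector of S, used as constant coefficients, meets both boundary conditions. Its
    exponential sum therefore solves the homogeneous equation and vanishes on [[-1,1]]. *)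
Lemma Sm_invertible (N : nat) (c mu : nat -> C) (tau0 alpha : R) (z : C)
  (rho : nat -> C) (Tinv : nat -> nat -> C) :
  (0 <= tau0)%R -> in_resolvent_set N c mu tau0 alpha z ->
  (forall a b, (a < 2 * N)%nat -> (b < 2 * N)%nat -> a <> b ->
     signed_root N rho a <> signed_root N rho b) ->
  (forall a, (a < 2 * N)%nat -> charP N c mu tau0 alpha z (signed_root N rho a) = 0) ->
  (forall j a, (j < N)%nat -> (a < 2 * N)%nat ->
     kk mu z j - signed_root N rho a <> 0 /\ kk mu z j + signed_root N rho a <> 0) ->
  is_inverse (2 * N) (Tm N mu z rho) Tinv ->
  exists Sinv, is_inverse (2 * N) (Sm N mu z rho) Sinv.
Proof.
intros Htau Hres Hdist HP Hk HT. apply injective_invertible. intros v Hv.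
apply (exponentials_independent (2 * N) v (signed_root N rho) (-1) 1); [lra|exact Hdist|].
assert (H := homogeneous_zero N c mu tau0 alpha z
  (fun x => RtoC 0 + csum (2 * N) (fun a => v a * cexp (signed_root N rho a * RtoC x)))
  Htau Hres).
(* The summand [RtoC 0] gives the sum the shape of the ansatz with [G = 0]. *)
intros x Hx. transitivity (RtoC 0 +
  csum (2 * N) (fun a => v a * cexp (signed_root N rho a * RtoC x))); [ring|].
apply H; [clear x Hx; intros x|clear x Hx; intros x Hx|lra].
- apply Ccont_plus; [apply Ccont_const|].
  apply (Ccont_csum (2 * N) (fun a x => v a * cexp (signed_root N rho a * RtoC x))).
  intros a _. apply Ccont_mult; [apply Ccont_const|apply cexp_linear_cont].
- rewrite (ansatz_solves N c mu tau0 alpha z rho (mvec (2 * N) Tinv (pm_ones N))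
    (fun a _ => v a) (fun _ => RtoC 0)); try easy; [ring| | | | |].
  + intros i Hi. now apply mvec_inverse.
  + intros; apply Ccont_const.
  + intros a r _. eapply Cderiv_eq; [|apply Cderiv_const]. ring.
  + intros j Hj. apply Hv. lia.
  + intros j Hj. apply Hv. lia.
Qed.

(** * Identification of [psi(0)] with the ansatz *)

(** Continuity of [hz] is read off the integral equation for a solution [psi], whose left side
    consists of exponentials and indefinite integrals. This avoids the double integral with moving
    limits. *)
Lemma hz_continuous_extension (N : nat) (c mu : nat -> C) (tau0 alpha : R) (z : C)
  (phi psi : R -> R -> C) :
  (0 <= tau0)%R -> inX (hh tau0) phi -> solves_resolvent N c mu tau0 alpha z phi psi ->
  exists H, (forall x, Ccont H x) /\
    forall x, (-1 <= x <= 1)%R -> H x = hz N c mu tau0 z phi x.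
Proof.
intros Htau Hphi Hsol.
set (Q := fun r => psi 0%R (clamp (-1) 1 r)).
assert (CQ : forall r, Ccont Q r).
{ intros r. apply inY_Ccont. destruct Hsol as [dpsi [[[HY _] _] _]].
  apply HY. unfold hh. lra. }
assert (Ce : forall k r, Ccont (fun r => cexp (k * RtoC r) * Q r) r)
  by (intros; apply Ccont_mult; [apply cexp_linear_cont|apply CQ]).
(* The integral from [x] to [1] is written as the one over [[-1,1]] minus the one from [-1] to [x],
   so only upper limits vary. *)
exists (fun x => (z + RtoC alpha) * Q x + (-(1)) * (cexp (- z * RtoC tau0) *
  csum N (fun j => c j *
    (cexp (- kk mu z j * RtoC x) * CInt (fun r => cexp (kk mu z j * RtoC r) * Q r) (-1) x
     + cexp (kk mu z j * RtoC x) *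
       (CInt (fun r => cexp (- kk mu z j * RtoC r) * Q r) (-1) 1 +
        (-(1)) * CInt (fun r => cexp (- kk mu z j * RtoC r) * Q r) (-1) x))))).
split; intros x.
- assert (CI : forall k, Ccont (CInt (fun r => cexp (k * RtoC r) * Q r) (-1)) x)
    by (intros k; eapply Cderiv_cont, CInt_deriv, Ce).
  apply Ccont_plus; [apply Ccont_mult; [apply Ccont_const|apply CQ]|].
  apply Ccont_mult; [apply Ccont_const|]. apply Ccont_mult; [apply Ccont_const|].
  apply (Ccont_csum N (fun j x => c j *
    (cexp (- kk mu z j * RtoC x) * CInt (fun r => cexp (kk mu z j * RtoC r) * Q r) (-1) x
     + cexp (kk mu z j * RtoC x) *
       (CInt (fun r => cexp (- kk mu z j * RtoC r) * Q r) (-1) 1 +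
        (-(1)) * CInt (fun r => cexp (- kk mu z j * RtoC r) * Q r) (-1) x)))).
  intros j _. apply Ccont_mult; [apply Ccont_const|].
  apply Ccont_plus; (apply Ccont_mult; [apply cexp_linear_cont|]); [apply CI|].
  apply Ccont_plus; [apply Ccont_const|].
  apply Ccont_mult; [apply Ccont_const|apply CI].
- intros Hx.
  rewrite <- (resolvent_integral_equation N c mu tau0 alpha z phi psi x Htau Hphi Hsol Hx).
  replace (Lop N c mu tau0 (fun th r => cexp (z * RtoC th) * psi 0%R r) x)
    with (Lop N c mu tau0 (fun th r => cexp (z * RtoC th) * Q r) x).
  + rewrite Lop_exponential_kernel by easy. unfold Q at 1. rewrite clamp_id by exact Hx.
    unfold Cminus. f_equal.
    match goal with |- _ = - (?a * ?b) =>
      transitivity (-(1) * (a * b)); [|ring] end.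
    do 2 f_equal. apply csum_ext. intros j _. do 3 f_equal.
    rewrite <- (CInt_Chasles (fun r => cexp (- kk mu z j * RtoC r) * Q r) (-1) x 1) by apply Ce.
    ring.
  + apply CInt_ext; [lra|]. intros r Hr. unfold Q. now rewrite clamp_id.
Qed.

Lemma Lop_exponential_minus (N : nat) (c mu : nat -> C) (tau0 : R) (z : C)
  (P Q : R -> C) (x : R) :
  (forall r, Ccont P r) -> (forall r, Ccont Q r) ->
  Lop N c mu tau0 (fun th r => cexp (z * RtoC th) * (P r - Q r)) x =
  Lop N c mu tau0 (fun th r => cexp (z * RtoC th) * P r) x -
  Lop N c mu tau0 (fun th r => cexp (z * RtoC th) * Q r) x.
Proof.
intros CP CQ. unfold Lop.
assert (Ck : forall F, (forall r, Ccont F r) -> forall r, Ccont (fun r => Jc N c mu x r *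
  (cexp (z * RtoC (- tau0 - Rabs (x - r))) * F r)) r).
{ intros F CF r. apply Ccont_mult; [apply Jc_cont|]. apply Ccont_mult; [|apply CF].
  apply (Ccont_comp (fun r => (- tau0 - Rabs (x - r))%R) (fun t => cexp (z * RtoC t)));
    [apply delay_cont|apply cexp_linear_cont]. }
rewrite (CInt_ext _ (fun r => Jc N c mu x r *
    (cexp (z * RtoC (- tau0 - Rabs (x - r))) * P r) + (-(1)) * (Jc N c mu x r *
    (cexp (z * RtoC (- tau0 - Rabs (x - r))) * Q r)))); [|lra|intros; ring].
rewrite CInt_plus, CInt_scal; [ring|lra|now apply Ck|lra|now apply Ck|].
intros r. apply Ccont_mult; [apply Ccont_const|now apply Ck].
Qed.

Lemma signed_root_neq (N : nat) (mu : nat -> C) (z : C) (rho : nat -> C) :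
  (forall i j, (i < N)%nat -> (j < N)%nat ->
     kk mu z j <> rho i /\ kk mu z j <> Copp (rho i)) ->
  forall j a, (j < N)%nat -> (a < 2 * N)%nat ->
     kk mu z j - signed_root N rho a <> 0 /\ kk mu z j + signed_root N rho a <> 0.
Proof.
intros Hk j a Hj Ha.
assert (Hd : forall k s : C, k <> s -> k <> - s -> k - s <> 0 /\ k + s <> 0).
{ intros k s H1 H2. split; intros E; [apply H1|apply H2].
  - replace k with (k - s + s) by ring. rewrite E. ring.
  - replace k with (k + s + - s) by ring. rewrite E. ring. }
unfold signed_root. destruct (Nat.ltb_spec a N).
- apply Hd; now apply Hk.
- destruct (Hk (a - N)%nat j ltac:(lia) Hj) as [H1 H2].
  apply Hd; [exact H2|]. now replace (- - rho (a - N)%nat) with (rho (a - N)%nat) by ring.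
Qed.

Lemma signed_root_charP (N : nat) (c mu : nat -> C) (tau0 alpha : R) (z : C)
  (rho : nat -> C) :
  (forall w, charP N c mu tau0 alpha z w = 0 <->
     exists i, (i < N)%nat /\ (w = rho i \/ w = - rho i)) ->
  forall a, (a < 2 * N)%nat -> charP N c mu tau0 alpha z (signed_root N rho a) = 0.
Proof.
intros H a Ha. apply H. unfold signed_root. destruct (Nat.ltb_spec a N).
- exists a. now split; [|left].
- exists (a - N)%nat. split; [lia|now right].
Qed.

(* The ansatz [F] with [gamma_a' = (h/(z+alpha)) w_a e^{- s_a x}], [T w = (-1, 1)], and [q = psi(0)]
   solve the same integral equation. *)
Lemma resolvent_initial_value (N : nat) (c mu : nat -> C) (tau0 alpha : R) (z : C)
  (rho : nat -> C) (Tinv Sinv : nat -> nat -> C) (x0 : R) (phi psi : R -> R -> C) (x : R) :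
  (0 <= tau0)%R -> in_resolvent_set N c mu tau0 alpha z ->
  (forall a, (a < 2 * N)%nat -> charP N c mu tau0 alpha z (signed_root N rho a) = 0) ->
  (forall j a, (j < N)%nat -> (a < 2 * N)%nat ->
     kk mu z j - signed_root N rho a <> 0 /\ kk mu z j + signed_root N rho a <> 0) ->
  z + RtoC alpha <> 0 ->
  is_inverse (2 * N) (Tm N mu z rho) Tinv -> is_inverse (2 * N) (Sm N mu z rho) Sinv ->
  (-1 <= x0 <= 1)%R -> inX (hh tau0) phi ->
  solves_resolvent N c mu tau0 alpha z phi psi -> (-1 <= x <= 1)%R ->
  psi 0%R x = qz N c mu tau0 alpha z rho Tinv Sinv phi x0 x.
Proof.
intros Htau0 Hres HP Hks Hza HTinv HS Hx0 Hphi Hsol Hx.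
destruct (hz_continuous_extension N c mu tau0 alpha z phi psi Htau0 Hphi Hsol)
  as [H [CH EH]].
set (w := mvec (2 * N) Tinv (pm_ones N)).
set (G := fun r => H r * / (z + RtoC alpha)).
assert (CG : forall r, Ccont G r)
  by (intros; apply Ccont_mult; [apply CH|apply Ccont_const]).
set (Gh := Gammahat N c mu tau0 alpha z rho Tinv phi x0).
set (G0 := Gamma0 N c mu tau0 alpha z rho Tinv Sinv phi x0).
(* [gam] integrates the extension [H] in place of [hz]. It is differentiable on all of R and agrees
   with [Gammaz] on [[-1,1]]. *)
set (gam := fun a t => G0 a + CInt (fun r => G r * (Pdiag N rho r a * w a)) x0 t).
assert (CPd : forall a r, Ccont (fun r => Pdiag N rho r a) r).
{ intros a r. unfold Pdiag. destruct (Nat.ltb a N); apply cexp_linear_cont. }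
assert (Egam : forall a t, (-1 <= t <= 1)%R -> gam a t = G0 a + Gh t a).
{ intros a t Ht. unfold gam. f_equal. apply (CInt_ext_on (-1) 1); [lra|lra|].
  intros r Hr. unfold G. now rewrite EH. }
assert (EPd : forall a r, Pdiag N rho r a = cexp (- signed_root N rho a * RtoC r)).
{ intros a r. unfold Pdiag, signed_root. destruct (Nat.ltb a N); [reflexivity|].
  f_equal. ring. }
assert (Dgam : forall a r, (a < 2 * N)%nat ->
  Cderiv (gam a) r (G r * (w a * cexp (- signed_root N rho a * RtoC r)))).
{ intros a r _. eapply Cderiv_eq; [|apply Cderiv_plus; [apply Cderiv_const|apply CInt_deriv]].
  - cbv beta. rewrite EPd. ring.
  - intros t. apply Ccont_mult; [apply CG|].
    apply Ccont_mult; [apply CPd|apply Ccont_const]. }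
(* Since [Gamma0] is minus [Sinv] applied to [Sbig] times the stacked vector, S cancels [Sinv]. Row
   [i] of S then annihilates [gam y] whenever row [i] of [Sbig] reproduces S applied to [Gh y]. *)
assert (HSG : forall y i, (i < 2 * N)%nat -> (-1 <= y <= 1)%R ->
  mvec (4 * N) (Sbig N mu z rho)
    (fun b => if Nat.ltb b (2 * N) then Gh 1%R b else Gh (-1)%R (b - 2 * N)%nat) i
  = mvec (2 * N) (Sm N mu z rho) (Gh y) i ->
  mvec (2 * N) (Sm N mu z rho) (fun a => gam a y) i = 0).
{ intros y i Hi Hy E.
  rewrite (mvec_ext _ _ _ (fun a => Gh y a - mvec (2 * N) Sinv (mvec (4 * N) (Sbig N mu z rho)
    (fun b => if Nat.ltb b (2 * N) then Gh 1%R b else Gh (-1)%R (b - 2 * N)%nat)) a)).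
  - rewrite mvec_minus, (mvec_inverse (2 * N) (Sm N mu z rho) Sinv _ i HS Hi), E. ring.
  - intros a _. rewrite Egam by exact Hy. unfold G0, Gamma0. fold Gh. ring. }
set (F := fun t => G t + csum (2 * N) (fun a => gam a t * cexp (signed_root N rho a * RtoC t))).
assert (CF : forall t, Ccont F t).
{ intros t. apply Ccont_plus; [apply CG|].
  apply (Ccont_csum (2 * N) (fun a t => gam a t * cexp (signed_root N rho a * RtoC t))).
  intros a Ha. apply Ccont_mult; [|apply cexp_linear_cont]. eapply Cderiv_cont, Dgam, Ha. }
set (Q := fun t => psi 0%R (clamp (-1) 1 t)).
assert (CQ : forall t, Ccont Q t).
{ intros t. apply inY_Ccont. destruct Hsol as [dpsi [[[HY _] _] _]].
  apply HY. unfold hh. lra. }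
assert (EF : F x = qz N c mu tau0 alpha z rho Tinv Sinv phi x0 x).
{ unfold F, qz. rewrite csum_double. f_equal.
  - unfold G. now rewrite EH.
  - apply csum_ext. intros i Hi. unfold Gammaz. rewrite !Egam by exact Hx.
    f_equal; f_equal; f_equal; unfold signed_root.
    + now apply Nat.ltb_lt in Hi as ->.
    + replace (Nat.ltb (N + i) N) with false by (symmetry; apply Nat.ltb_ge; lia).
      now replace (N + i - N)%nat with i by lia. }
rewrite <- EF.
(* Both [Q] and [F] solve the integral equation with right-hand side [H] on [[-1,1]], so their
   difference solves the homogeneous one. *)
assert (E0 : Q x - F x = 0).
{ apply (homogeneous_zero N c mu tau0 alpha z (fun t => Q t - F t)); try assumption.
  - intros t. apply (Ccont_ext (fun t => Q t + (-(1)) * F t)); [intros; ring|].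
    apply Ccont_plus; [apply CQ|]. apply Ccont_mult; [apply Ccont_const|apply CF].
  - intros y Hy. rewrite Lop_exponential_minus by assumption.
    unfold F at 1.
    rewrite (ansatz_solves N c mu tau0 alpha z rho w gam G y); try assumption.
    + replace (Lop N c mu tau0 (fun th r => cexp (z * RtoC th) * Q r) y)
        with (Lop N c mu tau0 (fun th r => cexp (z * RtoC th) * psi 0%R r) y).
      * pose proof (resolvent_integral_equation N c mu tau0 alpha z phi psi y
          Htau0 Hphi Hsol Hy) as Eq.
        rewrite <- EH in Eq by exact Hy.
        unfold F, G, Q. rewrite clamp_id by exact Hy. rewrite <- Eq. field. exact Hza.
      * apply CInt_ext; [lra|]. intros r Hr. unfold Q. now rewrite clamp_id.
    + intros i Hi. now apply mvec_inverse.
    + intros j Hj. apply HSG; [lia|lra|]. now apply Sbig_top.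
    + intros j Hj. apply HSG; [lia|lra|]. apply Sbig_bottom. }
unfold Q in E0. rewrite clamp_id in E0 by exact Hx.
replace (psi 0%R x) with (psi 0%R x - F x + F x) by ring. rewrite E0. ring.
Qed.
Open Scope R_scope.

Theorem theorem3p19
  (N : nat) (tau0 alpha : R) (c mu : nat -> C) (z : C) (rho : nat -> C)
  (Htau0 : 0 <= tau0) (Halpha : 0 < alpha)
  (Hc : forall i, (i < N)%nat -> c i <> RtoC 0)
  (Hmu : forall i j, (i < N)%nat -> (j < N)%nat -> i <> j -> mu i <> mu j)
  (* z ∈ ρ(A) *)
  (Hres : in_resolvent_set N c mu tau0 alpha z)
  (* z ∉ S *)
  (HnotS : forall i j, (i < N)%nat -> (j < N)%nat -> i <> j ->
     Cmult (kk mu z i) (kk mu z i) <> Cmult (kk mu z j) (kk mu z j))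
  (* P has the 2N distinct roots ±ρ_i(z), i = 1..N *)
  (Hdistinct : forall a b, (a < 2 * N)%nat -> (b < 2 * N)%nat -> a <> b ->
     signed_root N rho a <> signed_root N rho b)
  (Hroots : forall w : C, charP N c mu tau0 alpha z w = RtoC 0 <->
     exists i, (i < N)%nat /\ (w = rho i \/ w = Copp (rho i)))
  (* k_j(z) ≠ ±ρ_i(z) *)
  (Hk : forall i j, (i < N)%nat -> (j < N)%nat ->
     kk mu z j <> rho i /\ kk mu z j <> Copp (rho i))
  (* T(z) invertible *)
  (HT : exists Tinv, is_inverse (2 * N) (Tm N mu z rho) Tinv) :
  exists Sinv, is_inverse (2 * N) (Sm N mu z rho) Sinv /\
  forall Tinv, is_inverse (2 * N) (Tm N mu z rho) Tinv ->
  forall x0, -1 <= x0 <= 1 ->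
  forall phi psi : R -> R -> C, inX (hh tau0) phi ->
    solves_resolvent N c mu tau0 alpha z phi psi ->
    forall th x, - hh tau0 <= th <= 0 -> -1 <= x <= 1 ->
      psi th x = resolvent_formula z
                   (qz N c mu tau0 alpha z rho Tinv Sinv phi x0) phi th x.
Proof.
assert (HP := signed_root_charP N c mu tau0 alpha z rho Hroots).
assert (Hks := signed_root_neq N mu z rho Hk).
destruct HT as [Tinv0 HT0].
assert (Hza : Cplus z (RtoC alpha) <> RtoC 0).
{ apply (z_plus_alpha_neq_0 N c mu tau0 alpha z rho Tinv0); try assumption.
  destruct (Nat.eq_dec N 0) as [->|]; [left|right; lia].
  (* For [N = 0] the description of the roots says that [charP] has no zero. *)
  intros E. apply Hroots in E as [i [Hi _]]. lia. }
destruct (Sm_invertible N c mu tau0 alpha z rho Tinv0) as [Sinv HS]; try assumption.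
(* S is built from [mu], [z] and [rho] only, so one inverse serves all [Tinv], [x0] and [phi]. *)
exists Sinv. split; [exact HS|].
intros Tinv HTinv x0 Hx0 phi psi Hphi Hsol th x Hth Hx.
rewrite (resolvent_solution_form N c mu tau0 alpha z phi psi th x) by assumption.
unfold resolvent_formula. do 2 f_equal.
now apply resolvent_initial_value.
Qed.
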